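(* Let $D\subset\mathbb{C}^n$ be a B-regular domain. Every b-pluripolar set $A\subset\partial D$ that is a $G_\delta$ as well as an $F_\sigma$ is completely b-pluripolar. If, moreover, $\hat A$ is a $G_\delta$, then there is a negative $\psi\in\mathrm{PSH}(D)$ such that $\hat A=\{z\in\overline D:\psi^*(z)=-\infty\}$. In particular, $\hat A\cap D$ is then completely pluripolar.
   Context: $\mathrm{PSH}(D)$ denotes the family of all plurisubharmonic functions on $D$. For $u:D\to\mathbb{R}\cup\{-\infty\}$ and $x\in\overline D$, $u^*(x)=\limsup_{z\to x,\,z\in D}u(z)=\lim_{r\to0}\sup_{B(x,r)\cap D}u$. A bounded domain $D\subset\mathbb{C}^n$ is B-regular if every $f\in C(\partial D)$ can be extended to a plurisubharmonic function on $D$ that is continuous on $\overline D$. A set $A\subset\partial D$ is b-pluripolar if there exists $u\in\mathrm{PSH}(D)$, $u\le0$, $u\not\equiv-\infty$, such that $u^*=-\infty$ on $A$. It is completely b-pluripolar if there exists $u\in\mathrm{PSH}(D)$, $u<0$, $u\not\equiv-\infty$, such that $\{z\in\partial D:u^*(z)=-\infty\}=A$. The b-pluripolar hull of a b-pluripolar set $A\subset\partial D$ is $$\hat A=\{z\in\overline D:\ u^*(z)=-\infty\text{ for all }u\in\mathrm{PSH}(D)\text{ with }u\not\equiv-\infty,\ u<0,\ u^*|_A=-\infty\}.$$ A set $E\subset D$ is completely pluripolar if there exists $u\in\mathrm{PSH}(D)$ with $E=\{z\in D:u(z)=-\infty\}$. *)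

(* Defs.v *)
From HB Require Import structures.
From mathcomp Require Import all_boot all_order all_algebra complex.
From mathcomp Require Import all_classical all_reals all_analysis.
From mathcomp Require Import borel_hierarchy.

Set Implicit Arguments.
Unset Strict Implicit.
Unset Printing Implicit Defensive.

Import Order.TTheory GRing.Theory Num.Theory.
Import numFieldNormedType.Exports.

Local Open Scope classical_set_scope.
Local Open Scope ring_scope.
Local Open Scope complex_scope.
Local Open Scope ereal_scope.

(* The type [R[i]] itself carries no topology; bundling it as a
   [numClosedFieldType] gives it the one induced by the modulus.  The norm on
   ['rV[Cplx R]_n.+1] is the max norm, whose topology and bounded sets are the
   Euclidean ones. *)
Definition Cplx (R : realType) : numClosedFieldType := R[i].

Section Semicontinuity.
Context {R : realType} {T : topologicalType}.
Implicit Types (D : set T) (u : T -> \bar R).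

Definition usc_on D u := forall x, D x -> forall a : R, u x < a%:E ->
  \forall y \near within D (nbhs x), u y < a%:E.

(* u^*(x) is the limsup of u(z) as z tends to x within D; the value z = x is
   not excluded when x lies in D.  Functions on D are represented by total
   functions, whose values outside D are irrelevant. *)
Definition ustar D u (x : T) : \bar R := limf_esup u (within D (nbhs x)).

Definition bdry D : set T := closure D `\` D°.

End Semicontinuity.

Section Pluripotential.
Context {R : realType}.

Definition cis (t : R) : Cplx R := cos t +i* sin t.

Definition circle_mean (v : Cplx R -> \bar R) (c : Cplx R) (r : R) : \bar R :=
  ((2 * pi)^-1)%:E *
  \int[lebesgue_measure]_(t in `[0%R, (2 * pi)%R])
     v (c + (r%:C : Cplx R) * cis t)%R.

(* The set U is meant to be open; the function identically -oo on a component
   of U is allowed. *)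
Definition subharmonic (U : set (Cplx R)) (v : Cplx R -> \bar R) :=
  [/\ forall z, U z -> v z < +oo,
      usc_on U v &
      forall (c : Cplx R) (r : R), (0 < r)%R ->
        [set z : Cplx R | (`|z - c| <= (r%:C : Cplx R))%R] `<=` U ->
        v c <= circle_mean v c r].

Context {n : nat}.
Implicit Types (D A E : set 'rV[Cplx R]_n.+1) (u : 'rV[Cplx R]_n.+1 -> \bar R).

(* The constant -oo belongs to PSH(D). *)
Definition psh D u :=
  [/\ forall z, D z -> u z < +oo,
      usc_on D u &
      forall a b : 'rV[Cplx R]_n.+1,
        subharmonic [set l : Cplx R | D (a + l *: b)%R]
                    (fun l => u (a + l *: b)%R)].

Definition nontrivial D u := exists2 z, D z & u z != -oo.

Definition negative D u := forall z, D z -> u z < 0.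

Definition bounded_domain D :=
  [/\ open D, connected D, D !=set0 & bounded_set D].

Definition B_regular D :=
  bounded_domain D /\
  forall f : 'rV[Cplx R]_n.+1 -> R, {within bdry D, continuous f} ->
    exists g : 'rV[Cplx R]_n.+1 -> R,
      [/\ psh D (EFin \o g), {within closure D, continuous g} &
          forall z, bdry D z -> g z = f z].

Definition b_pluripolar D A :=
  A `<=` bdry D /\
  exists u, [/\ psh D u, forall z, D z -> u z <= 0, nontrivial D u &
                forall z, A z -> ustar D u z = -oo].

Definition completely_b_pluripolar D A :=
  exists u, [/\ psh D u, negative D u, nontrivial D u &
                [set z | bdry D z /\ ustar D u z = -oo] = A].

Definition b_hull D A : set 'rV[Cplx R]_n.+1 :=
  [set z | closure D z /\
     forall u, psh D u -> nontrivial D u -> negative D u ->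
       (forall w, A w -> ustar D u w = -oo) -> ustar D u z = -oo].

Definition completely_pluripolar D E :=
  exists2 u, psh D u & E = [set z | D z /\ u z = -oo].

End Pluripotential.

(* Main.v *)
Require Import Defs.
From HB Require Import structures.
From mathcomp Require Import all_boot all_order all_algebra complex.
From mathcomp Require Import all_classical all_reals all_analysis.
From mathcomp Require Import borel_hierarchy measurable_realfun.
From mathcomp Require Import ring lra.
Import Order.TTheory GRing.Theory Num.Theory.
Import numFieldNormedType.Exports.
Local Open Scope classical_set_scope.
Local Open Scope ring_scope.

Set Implicit Arguments.
Unset Strict Implicit.
Unset Printing Implicit Defensive.

(** Let [w <= 0] be plurisubharmonic, with boundary values [-oo] on [A].  Write
    [A] as an increasing union of compact sets [K k], and its complement in the
    boundary (for the second part: the complement of the hull in the closure of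
    [D]) as an increasing union of compact sets [L k]; the hypotheses on [A] and
    on its hull say exactly that this is possible.  The function sought is a
    series of plurisubharmonic functions [h k <= 0], each at most [- 1 / 2] near
    [K k] and at least [- 2 ^ - k] near [L k].  It has boundary values [-oo] on
    [A], hence, by definition, on the hull.

    The terms being small near [L k] does not bound the sum from below at its
    points, since the neighborhoods shrink.  Along with the terms one therefore
    chooses finite subsets of [D] that approximate the sets [L i]: a point enters
    where the terms chosen so far are under control, and the later terms are
    then required to be at least [- 2 ^ - j] at this point.  The sum is bounded
    below on a sequence of such points tending to a given point of [L k]
    ([series_construction]).

    It remains to find one term.  For a boundary point off [K k], B-regularity
    extends minus a multiple of the distance to this point to a continuous
    plurisubharmonic function.  In the first part the points of the finite sets
    are taken where [w] is finite, a dense set ([finite_dense]), and the maximum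
    with a small multiple of [w] takes care of them ([boundary_summand]).  In the
    second part, a point of [D] off the hull has its own function [u], finite
    there and with boundary values [-oo] on [A].  Compactness of [L k] could be
    used if [u] were continuous; Walsh's envelope ([envelope_exists]) replaces
    it by a larger continuous function that is still negative near [K k]
    ([test_function_at_interior], [hull_summand]).

    Walsh's argument glues translates of functions along the boundary, and the
    glued functions satisfy the submean inequality on small circles only.  All
    circles are recovered without solving a Dirichlet problem
    ([locally_submean_le_cmean]): averages over rotations of a disc still satisfy
    the maximum principle, and they converge to the mean over its boundary. *)

(** * The real-valued norm and compactness *)

Section Modulus.
Context {R : realType}.
Implicit Types (V : normedModType (Cplx R)).

(** The norm of [V] has values in [Cplx R], whose order is partial; its real part
    carries the same information. *)
Definition nrm V (y : V) : R := complex.Re `|y|.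

Lemma normE V (y : V) : `|y| = ((nrm y)%:C)%C :> Cplx R.
Proof.
have : (0 : Cplx R) <= `|y| by [].
by rewrite /nrm; move: (`|y|) => [a b] /=; rewrite lecE /= => /andP[/eqP ->].
Qed.

Lemma nrm_ge0 V (y : V) : 0 <= nrm y.
Proof. by have : (0 : Cplx R) <= `|y| by []; rewrite normE lecR. Qed.

Lemma nrm0 V : nrm (0 : V) = 0.
Proof. by rewrite /nrm normr0. Qed.

Lemma nrm0_eq0 V (y : V) : nrm y = 0 -> y = 0.
Proof. by move=> y0; apply/eqP; rewrite -normr_eq0 normE y0. Qed.

Lemma nrmN V (y : V) : nrm (- y) = nrm y.
Proof. by rewrite /nrm normrN. Qed.

Lemma nrmC V (x y : V) : nrm (x - y) = nrm (y - x).
Proof. by rewrite -nrmN opprB. Qed.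

Lemma nrmD V (x y : V) : nrm (x + y) <= nrm x + nrm y.
Proof.
have : (`|x + y| <= `|x| + `|y| :> Cplx R) by exact: ler_normD.
by rewrite !normE -rmorphD lecR.
Qed.

Lemma nrmB V (x y z : V) : nrm (x - z) <= nrm (x - y) + nrm (y - z).
Proof. by have := nrmD (x - y) (y - z); rewrite addrA subrK. Qed.

Lemma nrmZ V (l : Cplx R) (y : V) : nrm (l *: y) = nrm l * nrm y.
Proof.
have : `|l *: y| = `|l| * `|y| :> Cplx R by rewrite normrZ.
by rewrite !normE -rmorphM => /eqP; rewrite eq_complex /= => /andP[/eqP].
Qed.

Lemma nrm_le_norm V (y : V) (r : R) :
  (`|y| <= ((r%:C)%C : Cplx R)) = (nrm y <= r).
Proof. by rewrite normE lecR. Qed.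

Lemma nrm_cplx (l : Cplx R) :
  nrm l = Num.sqrt (complex.Re l ^+ 2 + complex.Im l ^+ 2).
Proof. by case: l => a b. Qed.

Lemma nrm_real (r : R) : nrm ((r%:C)%C : Cplx R) = `|r|.
Proof. by rewrite nrm_cplx /= expr0n /= addr0 sqrtr_sqr. Qed.

Lemma nrm_cis (t : R) : nrm (cis t) = 1.
Proof. by rewrite nrm_cplx /= cos2Dsin2 sqrtr1. Qed.

(** Neighborhoods are generated by balls whose radius is a positive element of
    [Cplx R]; such an element is real, so that balls of real radius suffice. *)
Lemma nbhs_nrmP V (x : V) (S : set V) :
  nbhs x S <-> exists2 r : R, 0 < r & forall y, nrm (y - x) < r -> S y.
Proof.
rewrite -filter_from_norm_nbhs; split=> [[e /= e0 eS]|[r r0 rS]].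
  exists (complex.Re e); first by move: e0; case: (e) => a b; rewrite ltcE => /andP[].
  move=> y yx; apply: eS; rewrite /= distrC normE ltcE /= yx andbT.
  by move: e0; rewrite ltcE /= => /andP[/eqP->].
exists ((r%:C)%C : Cplx R); first by rewrite /= ltcR.
by move=> y /=; rewrite distrC normE ltcR; exact: rS.
Qed.

Lemma near_nrmP V (x : V) (P : V -> Prop) :
  (\forall y \near x, P y) <->
  exists2 r : R, 0 < r & forall y, nrm (y - x) < r -> P y.
Proof. exact: nbhs_nrmP. Qed.

Lemma near_withinP V (D : set V) (x : V) (P : V -> Prop) :
  (\forall y \near within D (nbhs x), P y) <->
  exists2 r : R, 0 < r & forall y, D y -> nrm (y - x) < r -> P y.
Proof.
split=> [/near_nrmP[r r0 rP]|[r r0 rP]]; last apply/near_nrmP; exists r => // y.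
  by move=> Dy /rP; exact.
by move=> yr Dy; exact: rP.
Qed.

Lemma open_nrmP V (D : set V) : open D ->
  forall x, D x -> exists2 r : R, 0 < r & forall y, nrm (y - x) < r -> D y.
Proof. by move=> oD x Dx; apply/nbhs_nrmP/open_nbhs_nbhs. Qed.

Lemma closure_nrmP V (D : set V) (x : V) : closure D x <->
  forall r : R, 0 < r -> exists2 y, D y & nrm (y - x) < r.
Proof.
split=> [cx r r0|H B /nbhs_nrmP[r r0 rB]].
  have /cx[y [Dy yr]] : nbhs x [set y | nrm (y - x) < r].
    by apply/nbhs_nrmP; exists r.
  by exists y.
by have [y Dy yr] := H _ r0; exists y; split=> //; exact: rB.
Qed.

Lemma cvg_nrmP V (T : Type) (F : set_system T) (FF : Filter F) (f : T -> V) x :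
  f @ F --> x <-> forall e : R, 0 < e -> \forall t \near F, nrm (f t - x) < e.
Proof.
split=> [fx e e0|H S /nbhs_nrmP[r r0 rS]].
  by apply: (fx [set y | nrm (y - x) < e]); apply/nbhs_nrmP; exists e.
by rewrite /= nbhs_filterE; apply: filterS (H _ r0) => t; exact: rS.
Qed.

Lemma nrm_continuous V : continuous (@nrm V).
Proof.
move=> x; apply/cvgrPdist_lt => e e0; apply/nbhs_nrmP; exists e => // y.
apply: le_lt_trans; rewrite ler_norml.
have := nrmB x y 0; have := nrmB y x 0; rewrite !subr0 (nrmC x y) => *.
by apply/andP; split; lra.
Qed.

Lemma nrm_le_ReIm (l : Cplx R) : nrm l <= `|complex.Re l| + `|complex.Im l|.
Proof.
rewrite nrm_cplx -[leRHS]ger0_norm; last by rewrite addr_ge0.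
rewrite -[leRHS]sqrtr_sqr ler_sqrt ?sqr_ge0// sqrrD !real_normK ?num_real//.
by rewrite lerD2r lerDl mulrn_wge0 // mulr_ge0.
Qed.

Lemma Re_le_nrm (l : Cplx R) : `|complex.Re l| <= nrm l.
Proof. by rewrite nrm_cplx -sqrtr_sqr ler_sqrt ?addr_ge0 ?sqr_ge0// lerDl sqr_ge0. Qed.

Lemma Im_le_nrm (l : Cplx R) : `|complex.Im l| <= nrm l.
Proof. by rewrite nrm_cplx -sqrtr_sqr ler_sqrt ?addr_ge0 ?sqr_ge0// lerDr sqr_ge0. Qed.

Lemma compact_box (M : R) :
  compact [set l : Cplx R | `|complex.Re l| <= M /\ `|complex.Im l| <= M].
Proof.
pose f (p : R * R) : Cplx R := (p.1 +i* p.2)%C.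
have -> : [set l : Cplx R | `|complex.Re l| <= M /\ `|complex.Im l| <= M] =
    f @` (`[- M, M] `*` `[- M, M]).
  apply/seteqP; split=> [[a b] /= [aM bM]|_ /= [[a b] /= [+ +] <-]].
    by exists (a, b) => //; split; rewrite /= in_itv /= -ler_norml.
  by rewrite !in_itv/= !ler_norml => -> ->.
apply: continuous_compact; last first.
  by apply: compact_setX; exact: segment_compact.
apply: continuous_subspaceT => -[a b]; apply/cvg_nrmP => e e0.
have e20 : 0 < e / 2 by rewrite divr_gt0.
exists (ball a (e / 2), ball b (e / 2)); first by split; exact: nbhsx_ballx.
move=> [x y] /= [ax ay]; apply: (le_lt_trans (nrm_le_ReIm _)) => /=.
move: ax ay; rewrite /ball /= (distrC a) (distrC b) => *; lra.
Qed.

Lemma compact_bounded_rV n (S : set 'rV[Cplx R]_n) (M : R) :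
  closed S -> (forall y, S y -> nrm y <= M) -> compact S.
Proof.
move=> cS SM.
pose B := [set l : Cplx R | `|complex.Re l| <= M /\ `|complex.Im l| <= M].
apply: (subclosed_compact cS (@rV_compact _ _ (fun=> B) _)).
  by move=> i; exact: compact_box.
move=> y Sy i; have yi : nrm (y ord0 i) <= M.
  apply: le_trans (SM _ Sy).
  suff : `|y ord0 i| <= `|y| :> Cplx R by rewrite !normE lecR.
  rewrite [leRHS]/Num.norm /= mx_normE -[leLHS]nngE num_le.
  exact: (le_bigmax _ (fun k => `|y k.1 k.2|%:nng) (ord0, i)).
by split; apply: le_trans yi; [exact: Re_le_nrm|exact: Im_le_nrm].
Qed.

Lemma compact_bounded_cplx (S : set (Cplx R)) (M : R) :
  closed S -> (forall y, S y -> nrm y <= M) -> compact S.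
Proof.
move=> cS SM; apply: (subclosed_compact cS (@compact_box M)) => y /SM yM.
by split; apply: le_trans yM; [exact: Re_le_nrm|exact: Im_le_nrm].
Qed.

Lemma bounded_nrm V (D : set V) : bounded_set D ->
  exists M : R, forall y, closure D y -> nrm y <= M.
Proof.
move=> bD; have [N [Nr ND]] := bD.
exists (complex.Re (N + 1) + 1) => y /closure_nrmP/(_ 1 ltr01)[z Dz zy].
have /ND/(_ z Dz) : N < N + 1 by rewrite ltrDl.
rewrite /= normE lecE /= => /andP[_ zN].
have := nrmB y z 0; rewrite !subr0 nrmC; lra.
Qed.

Lemma dist_closed_gt0 V (K : set V) (z : V) : closed K -> ~ K z ->
  exists2 d : R, 0 < d & forall y, K y -> d <= nrm (y - z).
Proof.
move=> cK nKz; have /nbhs_nrmP[d d0 dK] : nbhs z (~` K).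
  by apply: open_nbhs_nbhs; split=> //; rewrite openC.
by exists d => // y Ky; rewrite leNgt; apply/negP => /dK.
Qed.

Lemma compact_uniform_near V (S : set V) (P : V -> Prop) : compact S ->
  (forall x, S x -> \forall y \near x, P y) ->
  exists2 r : R, 0 < r & forall x y, S x -> nrm (y - x) < r -> P y.
Proof.
move=> /compact_near_coveringP cS SP.
have := cS R (0^'+) (fun r x => forall y, nrm (y - x) < r -> P y) _.
case.
  move=> x Sx; have /near_nrmP[r r0 rP] := SP x Sx.
  exists ([set y | nrm (y - x) < r / 2], [set s | s < r / 2]).
    split=> /=; first by apply/nbhs_nrmP; exists (r / 2) => //; rewrite divr_gt0.
    by apply: nbhs_right_lt; rewrite divr_gt0.
  move=> [y s] /= [yx sr] z zy; apply: rP.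
  by have := nrmB z y x; lra.
move=> e /= e0 eP; exists (e / 2); first by rewrite divr_gt0.
move=> x y Sx; apply: (eP (e / 2)) => //=; last by rewrite divr_gt0.
by rewrite sub0r normrN gtr0_norm ?divr_gt0//; lra.
Qed.

Lemma cts_within_nrmP V (S : set V) (f : V -> R) : {within S, continuous f} ->
  forall x, S x -> forall e : R, 0 < e ->
  exists2 r : R, 0 < r & forall y, S y -> nrm (y - x) < r -> `|f y - f x| < e.
Proof.
move=> /subspace_continuousP cf x Sx e e0; apply/near_withinP.
have /cvgrPdist_lt/(_ e e0) := cf x Sx.
by apply: filterS => y; rewrite distrC.
Qed.

Lemma compact_ucontinuous V (S : set V) (f : V -> R) : compact S ->
  {within S, continuous f} -> forall e : R, 0 < e ->
  exists2 r : R, 0 < r &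
    forall x y, S x -> S y -> nrm (y - x) < r -> `|f y - f x| < e.
Proof.
move=> /compact_near_coveringP cS /cts_within_nrmP cf e e0.
have := cS R (0^'+)
  (fun r x => forall y, S x -> S y -> nrm (y - x) < r -> `|f y - f x| < e) _.
case.
  move=> x Sx; have [r r0 rP] := cf x Sx (e / 2) (divr_gt0 e0 (ltr0Sn _ _)).
  exists ([set y | nrm (y - x) < r / 2], [set s | s < r / 2]).
    split=> /=; first by apply/nbhs_nrmP; exists (r / 2) => //; rewrite divr_gt0.
    by apply: nbhs_right_lt; rewrite divr_gt0.
  move=> [y s] /= [yx sr] z Sy Sz zy.
  have fy : `|f y - f x| < e / 2 by apply: rP => //; lra.
  have fz : `|f z - f x| < e / 2 by apply: rP => //; have := nrmB z y x; lra.
  by have := ler_distD (f x) (f z) (f y); rewrite (distrC (f x)); lra.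
move=> d /= d0 dP; exists (d / 2); first by rewrite divr_gt0.
move=> x y Sx Sy; apply: (dP (d / 2)) => //=; last by rewrite divr_gt0.
by rewrite sub0r normrN gtr0_norm ?divr_gt0//; lra.
Qed.

End Modulus.

(** * Means over circles *)

Section Mean.
Context {R : realType}.
Local Notation mu := (@lebesgue_measure R).
Local Notation I2pi := `[0%R, (2 * pi)%R : R]%classic.
Implicit Types (f g : R -> \bar R).
Local Open Scope ereal_scope.

Let twopi_gt0 : (0 < 2 * pi :> R)%R.
Proof. by rewrite mulr_gt0 ?pi_gt0. Qed.

(** The positive parts and the negative parts compare separately, in opposite
    directions. *)
Lemma integral_le (S : set R) f g : measurable S ->
  measurable_fun S f -> measurable_fun S g -> (forall x, S x -> f x <= g x) ->
  \int[mu]_(x in S) f x <= \int[mu]_(x in S) g x.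
Proof.
move=> mS mf mg fg; rewrite [leLHS]integralE [leRHS]integralE; apply: leeB.
- apply: ge0_le_integral => //.
  + exact: measurable_funepos.
  + exact: measurable_funepos.
  + by move=> x /fg fgx; rewrite !funeposE; apply: le_max2.
- apply: ge0_le_integral => //.
  + exact: measurable_funeneg.
  + exact: measurable_funeneg.
  + by move=> x /fg fgx; rewrite !funenegE; apply: le_max2 => //; rewrite leeN2.
Qed.

Definition cmean f : \bar R := ((2 * pi)^-1)%:E * \int[mu]_(t in I2pi) f t.

Definition usc1 f := forall t (a : R), f t < a%:E -> \forall s \near t, f s < a%:E.

Lemma usc1_measurable (S : set R) f : usc1 f -> measurable_fun S f.
Proof.
move=> uf; have mNf : measurable_fun setT (fun t => - f t).
  apply: lower_semicontinuous_measurable => t a.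
  rewrite lteNr => ft; exists [set s | f s < (- a)%:E]; first exact: uf.
  by move=> s /=; rewrite lteNr.
apply: measurable_funTS; rewrite (_ : f = fun t => - - f t).
  exact: measurableT_comp.
by apply/funext => t; rewrite oppeK.
Qed.

Lemma cmean_le f g : measurable_fun I2pi f -> measurable_fun I2pi g ->
  (forall t, I2pi t -> f t <= g t) -> cmean f <= cmean g.
Proof.
move=> mf mg fg; rewrite /cmean lee_pmul2l ?lte_fin ?invr_gt0//.
exact: integral_le.
Qed.

Lemma eq_cmean f g : (forall t, f t = g t) -> cmean f = cmean g.
Proof. by move=> /funext ->. Qed.

Lemma measure_I2pi : lebesgue_measure I2pi = (2 * pi)%:E.
Proof. by rewrite lebesgue_measure_itv /= lte_fin twopi_gt0 sube0. Qed.

Lemma cmean_cst (a : R) : cmean (cst a%:E) = a%:E.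
Proof.
rewrite /cmean integral_cst//= measure_I2pi -!EFinM; congr (_%:E).
by rewrite mulrCA mulVf ?mulr1// gt_eqF.
Qed.

Lemma cmeanN f : (forall t, I2pi t -> 0 <= f t) ->
  cmean (fun t => - f t) = - cmean f.
Proof. by move=> f0; rewrite /cmean integral_ge0N// muleN. Qed.

Lemma cmean_ge0 f : (forall t, I2pi t -> 0 <= f t) -> 0 <= cmean f.
Proof.
move=> f0; rewrite mule_ge0 ?integral_ge0// lee_fin invr_ge0 ltW//.
Qed.

Lemma cmeanD_le0 f g : measurable_fun I2pi f -> measurable_fun I2pi g ->
  (forall t, f t <= 0) -> (forall t, g t <= 0) ->
  cmean (fun t => f t + g t) = cmean f + cmean g.
Proof.
move=> mf mg f0 g0.
have nf0 t : 0 <= - f t by rewrite oppe_ge0.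
have ng0 t : 0 <= - g t by rewrite oppe_ge0.
rewrite -[in LHS](@eq_cmean (fun t => - (- f t + - g t))); last first.
  by move=> t; rewrite -oppeD ?oppeK// ltpinfty_adde_def// inE (le_lt_trans _ (ltry 0)).
rewrite cmeanN; last by move=> t _; rewrite adde_ge0.
rewrite -[in RHS](@eq_cmean (fun t => - - f t) f); last by move=> t; rewrite oppeK.
rewrite -[in RHS](@eq_cmean (fun t => - - g t) g); last by move=> t; rewrite oppeK.
rewrite (@cmeanN (fun t => - f t))// (@cmeanN (fun t => - g t))// -oppeD; last first.
  by rewrite ge0_adde_def// inE cmean_ge0.
congr (- _); rewrite /cmean ge0_integralD//; last 2 first.
  exact: measurableT_comp.
  exact: measurableT_comp.
by rewrite ge0_muleDr // integral_ge0.
Qed.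

Lemma cmeanZ_le0 f (c : R) : (0 <= c)%R -> measurable_fun I2pi f ->
  (forall t, f t <= 0) -> cmean (fun t => c%:E * f t) = c%:E * cmean f.
Proof.
move=> c0 mf f0; have nf0 t : 0 <= - f t by rewrite oppe_ge0.
rewrite -[in LHS](@eq_cmean (fun t => - (c%:E * - f t))); last first.
  by move=> t; rewrite muleN oppeK.
rewrite cmeanN; last by move=> t _; rewrite mule_ge0.
rewrite -[in RHS](@eq_cmean (fun t => - - f t) f); last by move=> t; rewrite oppeK.
rewrite cmeanN // muleN; congr (- _); rewrite /cmean ge0_integralZl//.
  by rewrite muleCA.
exact: measurableT_comp.
Qed.

Lemma cmean_sum_le0 (N : nat) (f : nat -> R -> \bar R) :
  (forall k, measurable_fun I2pi (f k)) -> (forall k t, f k t <= 0) ->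
  cmean (fun t => \sum_(k < N) f k t) = \sum_(k < N) cmean (f k).
Proof.
move=> mf f0; elim: N => [|N IH].
  rewrite big_ord0 -[RHS](@cmean_cst 0); apply: eq_cmean => t.
  by rewrite big_ord0.
rewrite big_ord_recr /= -IH -cmeanD_le0//.
- by apply: eq_cmean => t; rewrite big_ord_recr.
- exact: emeasurable_sum.
- by move=> t; apply: sume_le0.
Qed.

Lemma cmean_nneseries (f : nat -> R -> \bar R) :
  (forall k, measurable_fun I2pi (f k)) -> (forall k t, 0 <= f k t) ->
  cmean (fun t => \sum_(0 <= k <oo) f k t) = \sum_(0 <= k <oo) cmean (f k).
Proof.
move=> mf f0; rewrite /cmean integral_nneseries//.
by rewrite nneseriesZl// => k _; exact: integral_ge0.
Qed.

(** The source of strict inequalities: an arc on which [f] is smaller lowers the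
    mean by an amount proportional to its length. *)
Lemma cmean_arc f (M a tau : R) : (0 < tau <= 2 * pi)%R ->
  measurable_fun I2pi f ->
  (forall t, I2pi t -> f t <= M%:E) ->
  (forall t, (0 <= t <= tau)%R -> f t <= a%:E) ->
  cmean f <= (M - (M - a) * (tau / (2 * pi)))%:E.
Proof.
move=> /andP[t0 t2pi] mf fM fa.
have split_I : I2pi = `[0%R, tau]%classic `|` `]tau, (2 * pi)%R]%classic.
  rewrite -itv_bndbnd_setU// bnd_simp//; first exact: ltW.
have m1 : measurable `[0%R, tau]%classic by [].
have m2 : measurable `]tau, (2 * pi)%R]%classic by [].
have mf1 : measurable_fun `[0%R, tau]%classic f.
  by apply: measurable_funS mf => //; rewrite split_I; exact: subsetUl.
have mf2 : measurable_fun `]tau, (2 * pi)%R]%classic f.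
  by apply: measurable_funS mf => //; rewrite split_I; exact: subsetUr.
have i1 : \int[mu]_(t in `[0%R, tau]) f t <= (a * tau)%:E.
  have -> : (a * tau)%:E = \int[mu]_(t in `[0%R, tau]) cst a%:E t.
    by rewrite integral_cst//= lebesgue_measure_itv /= lte_fin t0 sube0 EFinM.
  apply: integral_le => // t /=; rewrite in_itv /=; exact: fa.
have i2 : \int[mu]_(t in `]tau, (2 * pi)%R]) f t <= (M * (2 * pi - tau))%:E.
  have -> : (M * (2 * pi - tau))%:E = \int[mu]_(t in `]tau, (2 * pi)%R]) cst M%:E t.
    rewrite integral_cst//= lebesgue_measure_itv /= lte_fin; case: ltP => h.
      by rewrite EFinM EFinB.
    have -> : tau = (2 * pi)%R by apply/eqP; rewrite eq_le t2pi h.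
    by rewrite subrr mulr0 mule0.
  apply: integral_le => // t It; apply: fM; rewrite split_I; right; exact: It.
rewrite /cmean split_I integral_setU//; last 2 first.
- by rewrite -split_I.
- apply/disj_setPS => t [] /=; rewrite !in_itv /= => /andP[_ ta] /andP[tb _].
  by move: (lt_le_trans tb ta); rewrite ltxx.
apply: (@le_trans _ _ (((2 * pi)^-1)%:E * (a * tau + M * (2 * pi - tau))%:E)).
  by rewrite lee_pmul2l// ?lte_fin ?invr_gt0// EFinD leeD.
rewrite -EFinM lee_fin le_eqVlt; apply/orP; left; apply/eqP.
have : (pi : R) != 0%R by rewrite gt_eqF ?pi_gt0.
by move: (pi : R) => p p0; field.
Qed.

End Mean.

(** * Discs and the submean inequality *)

Section Circles.
Context {R : realType} {V : normedModType (Cplx R)}.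
Local Notation I2pi := `[0%R, (2 * pi)%R : R]%classic.
Implicit Types (D : set V) (u v : V -> \bar R) (p b : V).

Lemma cis_continuous : continuous (@cis R : R -> Cplx R).
Proof.
move=> t; apply/cvg_nrmP => e e0.
have e20 : 0 < e / 2 by rewrite divr_gt0.
have /cvgrPdist_lt/(_ _ e20) c1 := @continuous_cos R t.
have /cvgrPdist_lt/(_ _ e20) c2 := @continuous_sin R t.
near=> s; apply: (le_lt_trans (nrm_le_ReIm _)) => /=.
rewrite (_ : e = e / 2 + e / 2); last by lra.
by rewrite distrC (distrC (sin s)) ltrD//; near: s.
Unshelve. all: by end_near. Qed.

Lemma cis0 : cis 0 = 1 :> Cplx R.
Proof. by rewrite /cis cos0 sin0. Qed.

Lemma circle_continuous p b : continuous (fun t : R => p + cis t *: b : V).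
Proof.
move=> t; apply: cvgD; first exact: cvg_cst.
by apply: cvgZr_tmp; exact: cis_continuous.
Qed.

(** A disc is parametrized by its vector radius [b], so that rotating it means
    multiplying [b] by a unit complex number. *)
Definition disc p b := [set p + l *: b | l in [set l : Cplx R | nrm l <= 1]].

Lemma disc_center p b : disc p b p.
Proof. by exists 0; rewrite /= ?nrm0// scale0r addr0. Qed.

Lemma disc_circle p b t : disc p b (p + cis t *: b).
Proof. by exists (cis t) => //=; rewrite nrm_cis. Qed.

Lemma disc_nrm p b q : disc p b q -> nrm (q - p) <= nrm b.
Proof.
move=> [l /= l1 <-]; rewrite addrAC subrr add0r nrmZ ler_piMl// nrm_ge0//.
Qed.

Definition submean u p b := (u p <= cmean (fun t => u (p + cis t *: b)%R))%E.

Lemma usc_on_nrm D u : usc_on D u -> forall x, D x -> forall a : R, (u x < a%:E)%E ->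
  exists2 r, 0 < r & forall y, D y -> nrm (y - x) < r -> (u y < a%:E)%E.
Proof. by move=> uu x Dx a /(uu x Dx)/near_withinP. Qed.

Lemma usc_circle D u p b : usc_on D u -> disc p b `<=` D ->
  usc1 (fun t => u (p + cis t *: b)).
Proof.
move=> uu dD t a /(usc_on_nrm uu (dD _ (disc_circle p b t)))[r r0 rP].
have /cvg_nrmP/(_ r r0) := @circle_continuous p b t.
by apply: filterS => s; apply: rP; exact/dD/disc_circle.
Qed.

Lemma usc_circle_measurable D u p b : usc_on D u -> disc p b `<=` D ->
  measurable_fun I2pi (fun t => u (p + cis t *: b)).
Proof. by move=> uu dD; apply: usc1_measurable; exact: usc_circle uu dD. Qed.

End Circles.

Section PSH.
Context {R : realType} {n : nat}.
Local Notation V := 'rV[Cplx R]_n.+1.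
Implicit Types (D : set V) (u : V -> \bar R).

Lemma circle_meanE u (a b : V) (c : Cplx R) (r : R) :
  circle_mean (fun l => u (a + l *: b)) c r =
  cmean (fun t => u (a + c *: b + cis t *: ((r%:C)%C *: b : V))).
Proof.
rewrite /circle_mean; congr (_ * _)%E; apply: eq_integral => t _.
by rewrite scalerDl addrA scalerA [cis t * _]mulrC.
Qed.

(** Every disc of a complex line is [disc p b] for its centre [p] and a vector
    [b] directing the line, which need not be mentioned further. *)
Lemma pshP D u : open D -> psh D u <->
  [/\ forall z, D z -> (u z < +oo)%E, usc_on D u &
      forall p b, disc p b `<=` D -> submean u p b].
Proof.
move=> oD; split=> [[uoo uu us]|[uoo uu us]]; split=> //.
  move=> p b dD; have [_ _ /(_ 0 1 ltr01)] := us p b.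
  rewrite scale0r addr0 circle_meanE scale0r addr0 scale1r; apply.
  move=> l /=; rewrite subr0 nrm_le_norm => l1; apply: dD.
  by exists l.
move=> a b; split.
- by move=> z /uoo.
- move=> l Dl c /(usc_on_nrm uu Dl)[r r0 rP]; apply/near_withinP.
  have b0 := nrm_ge0 b.
  exists (r / (nrm b + 1)); first by rewrite divr_gt0// ltr_wpDl.
  move=> k Dk kl; apply: rP => //.
  rewrite opprD addrACA subrr add0r -scalerBl nrmZ.
  have b1 : 0 < nrm b + 1 by rewrite ltr_wpDl.
  move: kl; rewrite ltr_pdivlMr// => kl; apply: le_lt_trans kl.
  by rewrite ler_wpM2l ?nrm_ge0// lerDl.
- move=> c r r0 cD; rewrite circle_meanE; apply: us => _ [l /= l1 <-].
  rewrite scalerA -addrA -scalerDl; apply: cD => /=.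
  rewrite addrAC subrr add0r nrm_le_norm.
  by rewrite -[_ * _]/(l *: ((r%:C)%C : Cplx R)) nrmZ nrm_real gtr0_norm// ler_piMl// ltW.
Qed.

End PSH.

(** * The maximum principle *)

Section MaximumPrinciple.
Context {R : realType} {V : normedModType (Cplx R)}.
Implicit Types (C D U : set V) (s w : V -> \bar R) (p b : V).
Local Notation I2pi := `[0%R, (2 * pi)%R : R]%classic.

Lemma cmean_lt (f : R -> \bar R) (M : R) : usc1 f ->
  (forall t, (f t <= M%:E)%E) -> (f 0%R < M%:E)%E -> (cmean f < M%:E)%E.
Proof.
move=> uf fM f0; have [a fa aM] : exists2 a : R, (f 0%R < a%:E)%E & a < M.
  case E : (f 0) => [r| |]; rewrite E in f0; last by exists (M - 1); rewrite ?ltNyr//; lra.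
    by rewrite lte_fin in f0; exists ((r + M) / 2); rewrite ?lte_fin; lra.
  by [].
have [r r0 rP] := (nbhs_ballP _ _).1 (uf _ _ fa).
have pi2 := pi_ge2 R.
have t0 : 0 < Num.min (r / 2) 1 by rewrite lt_min ltr01 andbT divr_gt0.
set tau := Num.min (r / 2) 1 in t0.
have tr : tau <= r / 2 by rewrite ge_min lexx.
have t1 : tau <= 1 by rewrite ge_min lexx orbT.
apply: le_lt_trans (@cmean_arc _ f M a tau _ _ _ _) _.
- by rewrite t0/=; lra.
- exact: usc1_measurable.
- by [].
- move=> t /andP[t0' ttau]; apply/ltW/rP.
  by rewrite /ball /= sub0r normrN ger0_norm//; move: r0 => /=; lra.
- rewrite lte_fin ltrBlDr ltrDl mulr_gt0 ?subr_gt0// divr_gt0//; lra.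
Qed.

Lemma cmean_Noo (f : R -> \bar R) (M : R) : usc1 f ->
  (forall t, (f t <= M%:E)%E) -> (\forall t \near 0, f t = -oo%E) -> cmean f = -oo%E.
Proof.
move=> uf fM /nbhs_ballP[r /= r0 rP].
have pi2 := pi_ge2 R.
have t0 : 0 < Num.min (r / 2) 1 by rewrite lt_min ltr01 andbT divr_gt0.
set tau := Num.min (r / 2) 1 in t0.
have tr : tau <= r / 2 by rewrite ge_min lexx.
have t1 : tau <= 1 by rewrite ge_min lexx orbT.
have k0 : 0 < tau / (2 * pi) by rewrite divr_gt0//; lra.
apply: eq_ninfty => A.
(* The value on the arc that makes the bound of the mean equal to [A]. *)
pose a := M - (M - A) / (tau / (2 * pi)).
apply: le_trans (@cmean_arc _ f M a tau _ _ _ _) _.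
- by rewrite t0/=; lra.
- exact: usc1_measurable.
- by [].
- move=> t /andP[t0' ttau]; rewrite rP ?leNye//.
  by rewrite /ball /= sub0r normrN ger0_norm//; lra.
- by rewrite lee_fin /a subKr mulfVK ?gt_eqF// subKr.
Qed.

(** A cluster point of the sets where [s] exceeds the numbers below its supremum
    is a maximum. *)
Lemma usc_attains_max C s c : compact C -> usc_on C s -> C c ->
  exists2 m, C m & forall z, C z -> (s z <= s m)%E.
Proof.
move=> cC us Cc; have [sc|sc] := eqVneq (ereal_sup (s @` C)) -oo%E.
  exists c => // z Cz; have : (s z <= ereal_sup (s @` C))%E.
    by apply: ereal_sup_ubound; exists z.
  by rewrite sc leeNy_eq => /eqP ->; rewrite leNye.
set S := ereal_sup _ in sc.
pose F := filter_from [set a : \bar R | (a < S)%E] (fun a => [set z | C z /\ (a < s z)%E]).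
have FF : ProperFilter F.
  apply: filter_from_proper; last first.
    by move=> a /= /ereal_sup_gt[_ [z Cz <-] az]; exists z.
  apply: filter_from_filter.
    by exists -oo%E; rewrite /= ltNye.
  move=> a a' aS aS'; exists (maxe a a'); first by rewrite /= gt_max aS.
  by move=> z [Cz]; rewrite gt_max => /andP[].
have FC : F C by exists -oo%E; rewrite /= ?ltNye// => z [].
have [x [Cx clx]] := cC F FF FC.
exists x => // z Cz; have : (s z <= S)%E by apply: ereal_sup_ubound; exists z.
move=> /le_trans; apply; rewrite leNgt; apply/negP => sxS.
have [a sxa aS] : exists2 a : R, (s x < a%:E)%E & (a%:E < S)%E.
  move: sxS; case: (s x) => [r| |//]; case: S {F FF FC clx sc} => [r'| |]//.
  - by rewrite lte_fin => rr; exists ((r + r') / 2); rewrite lte_fin; lra.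
  - by move=> _; exists (r + 1); rewrite ?ltry// lte_fin; lra.
  - by move=> _; exists (r' - 1); rewrite ?ltNyr// lte_fin; lra.
  - by move=> _; exists 0; rewrite ?ltry ?ltNyr.
have nx := us x Cx a sxa; rewrite near_withinE in nx.
have Fa : F [set z | C z /\ (a%:E < s z)%E] by exists a%:E.
have [y [[Cy ay] ya]] := clx _ _ Fa nx.
by have := lt_trans ay (ya Cy); rewrite ltxx.
Qed.

(** Among the points where the maximum is attained, one of largest norm cannot
    lie in [U]: a small circle around it passes through a point of larger norm,
    where the function is strictly smaller, and so is its mean on the circle. *)
Lemma max_principle C U s c (e : V) : e != 0 -> compact C ->
  usc_on C s -> (forall z, C z -> (s z < +oo)%E) ->
  (forall z, U z -> exists2 r : R, 0 < r & forall b, nrm b < r ->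
     disc z b `<=` C /\ submean s z b) ->
  C c -> (-oo < s c)%E -> exists2 m, C m /\ ~ U m & (s c <= s m)%E.
Proof.
move=> e0 cC us soo sU Cc sc.
have [m Cm mmax] := usc_attains_max cC us Cc.
have [M sM] : exists M : R, s m = M%:E.
  have := soo m Cm; have := lt_le_trans sc (mmax _ Cc).
  by case: (s m) => // r; exists r.
(* The maximum of [s2] on [C] is attained at a maximum of [s] of largest norm. *)
pose s2 z := if (M%:E <= s z)%E then (nrm z)%:E else -oo%E.
have us2 : usc_on C s2.
  move=> z Cz a; rewrite /s2; case: (leP M%:E (s z)) => Ms za; last first.
    have := us z Cz _ Ms; apply: filterS => y yM.
    by rewrite leNgt yM /= ltNyr.
  have /cvgrPdist_lt/(_ (a - nrm z)) := @nrm_continuous _ V z.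
  rewrite subr_gt0 => /(_ za) nz.
  apply: cvg_within; move: nz; apply: filterS => y yz; case: ifP; rewrite ?ltNyr//.
  move=> _; rewrite lte_fin; have := ler_norm (nrm y - nrm z).
  by rewrite distrC; move: yz; lra.
have [m2 Cm2 m2max] := usc_attains_max cC us2 Cc.
have sm2 : s m2 = M%:E.
  apply/eqP; rewrite eq_le -{1}sM mmax//= leNgt; apply/negP => lt2.
  by have := m2max m Cm; rewrite /s2 sM lexx (leNgt _ (s m2)) lt2 /= leeNy_eq.
exists m2; last by rewrite sm2 -sM mmax.
split=> // /sU[r r0 rP].
have [b br mb] : exists2 b, nrm b < r & nrm m2 < nrm (m2 + b).
  have ne0 (x : V) : x != 0 -> 0 < nrm x.
    by move=> x0; rewrite lt_neqAle nrm_ge0 andbT eq_sym; apply: contra_neq x0 => /nrm0_eq0.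
  have [m20|m20] := eqVneq m2 0.
    have e1 := ne0 e e0.
    exists (((r / 2 / nrm e)%:C)%C *: e); rewrite ?m20 ?add0r nrmZ nrm_real gtr0_norm ?divr_gt0//.
      by rewrite -mulrA mulVf ?mulr1 ?gt_eqF//; lra.
    by rewrite nrm0 mulr_gt0 ?divr_gt0.
  have e1 := ne0 m2 m20.
  exists (((r / 2 / nrm m2)%:C)%C *: m2).
    rewrite nrmZ nrm_real gtr0_norm ?divr_gt0//.
    by rewrite -mulrA mulVf ?mulr1 ?gt_eqF//; lra.
  rewrite -{2}[m2]scale1r -scalerDl nrmZ -[1]/((1%:C)%C : Cplx R) -rmorphD nrm_real.
  by rewrite ltr_pMl// gtr0_norm ?addr_gt0 ?divr_gt0// ltrDl !divr_gt0.
have [dC] := rP b br; rewrite /submean sm2 leNgt; apply/negP/negPn.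
apply: cmean_lt.
- exact: usc_circle us dC.
- by move=> t; rewrite -sM; apply: mmax; exact/dC/disc_circle.
- rewrite cis0 scale1r ltNge; apply/negP => Ms.
  have Cmb : C (m2 + b).
    by have := dC _ (disc_circle m2 b 0); rewrite cis0 scale1r.
  have := m2max _ Cmb; rewrite /s2 Ms sm2 lexx lee_fin leNgt mb//.
Qed.

(** The value [-oo] near a point propagates: a circle through this point has an
    arc of [-oo] on it, hence the mean [-oo], and so its centre has the value
    [-oo] too.  The interior of the set where [w] is [-oo] is therefore closed in
    [D], and empty if [w] is finite somewhere. *)
Lemma finite_dense D w : open D -> connected D -> usc_on D w ->
  (forall z, D z -> (w z <= 0)%E) ->
  (forall p b, disc p b `<=` D -> submean w p b) ->
  (exists2 z, D z & w z != -oo%E) ->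
  forall z (r : R), D z -> 0 < r -> exists2 y, D y & nrm (y - z) < r /\ w y != -oo%E.
Proof.
move=> oD cD uw w0 sw [z0 Dz0 wz0] z r Dz r0; apply: contrapT => nz.
pose O : set V := [set x : V | \forall y \near x, D y -> w y = -oo%E].
have OW : D `&` O !=set0.
  exists z; split=> //; apply/near_nrmP; exists r => // y yr Dy.
  by apply/eqP/negPn/negP => wy; apply: nz; exists y.
have oO : open O.
  by rewrite openE => x Ox; exact: (nbhs_interior Ox).
have clO : D `&` O = D `&` closure (D `&` O).
  apply/seteqP; split=> [x Ox|x [Dx cx]]; first by split; [case: Ox|exact: subset_closure].
  split=> //; have [d d0 dD] := open_nrmP oD Dx.
  have d4 : 0 < d / 4 by lra.
  have [p [Dp Op] px] := (closure_nrmP _ _).1 cx _ d4.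
  apply/near_nrmP; exists (d / 4) => // q qx Dq.
  have bpq : nrm (p - q) < d / 2 by have := nrmB p x q; rewrite (nrmC x q); lra.
  have dd : disc q (p - q) `<=` D.
    move=> y /disc_nrm yq; apply: dD; have := nrmB y q x; lra.
  apply/eqP; rewrite -leeNy_eq; apply: le_trans (sw _ _ dd) _.
  rewrite (@cmean_Noo _ 0)//; first exact: usc_circle uw dd.
    by move=> t; apply: w0; exact/dd/disc_circle.
  have cc := @circle_continuous _ _ q (p - q) 0.
  have Op' : nbhs (q + cis 0 *: (p - q)) (fun y => D y -> w y = -oo%E).
    by rewrite cis0 scale1r addrC subrK.
  by have := cc _ Op'; apply: (@filterS _ (nbhs (0 : R))) => t; apply; exact/dd/disc_circle.
have : D `&` O = D.
  apply: cD => //; first by exists O.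
  by exists (closure (D `&` O)) => //; exact: closed_closure.
move=> /seteqP[_ /(_ z0 Dz0)[_ Oz0]]; have := nbhs_singleton Oz0 Dz0.
by move/eqP; rewrite (negbTE wz0).
Qed.

End MaximumPrinciple.

(** * Operations on plurisubharmonic functions *)

Section UpperSemicontinuous.
Context {R : realType} {T : topologicalType}.
Implicit Types (D : set T) (u v : T -> \bar R).

Lemma usc_on_max D u v : usc_on D u -> usc_on D v ->
  usc_on D (fun z => maxe (u z) (v z)).
Proof.
move=> uu uv z Dz a; rewrite gt_max => /andP[ua va].
by near do rewrite gt_max; apply: filterS2 (uu z Dz a ua) (uv z Dz a va) => y -> ->.
Unshelve. all: by end_near. Qed.

Lemma lt_adde_split (x y : \bar R) (a : R) : (x < +oo)%E -> (y < +oo)%E ->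
  (x + y < a%:E)%E ->
  exists a1 a2 : R, [/\ (x < a1%:E)%E, (y < a2%:E)%E & a1 + a2 <= a].
Proof.
case: x => [x| |]//; case: y => [y| |]// _ _.
- rewrite -EFinD lte_fin => xya; exists ((a + x - y) / 2), ((a + y - x) / 2).
  by rewrite !lte_fin; split; lra.
- by move=> _; exists (x + 1), (a - x - 1); rewrite lte_fin ltNyr; split => //; lra.
- by move=> _; exists (a - y - 1), (y + 1); rewrite lte_fin ltNyr; split => //; lra.
- by move=> _; exists 0, a; rewrite !ltNyr add0r.
Qed.

Lemma usc_on_add D u v : (forall z, D z -> (u z < +oo)%E) ->
  (forall z, D z -> (v z < +oo)%E) -> usc_on D u -> usc_on D v ->
  usc_on D (fun z => (u z + v z)%E).
Proof.
move=> uoo voo uu uv z Dz a /(lt_adde_split (uoo z Dz) (voo z Dz))[a1 [a2 [u1 v2 a12]]].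
apply: filterS2 (uu z Dz a1 u1) (uv z Dz a2 v2) => y ua va.
by apply: (@lt_le_trans _ _ (a1 + a2)%:E); rewrite ?lee_fin// EFinD lteD.
Qed.

Lemma usc_on_scale D u (c : R) : 0 < c -> usc_on D u ->
  usc_on D (fun z => (c%:E * u z)%E).
Proof.
move=> c0 uu z Dz a; rewrite muleC -lte_pdivlMr// -EFinM => uca.
apply: filterS (uu z Dz _ uca) => y.
by rewrite EFinM lte_pdivlMr// muleC.
Qed.

Lemma usc_on_cst D (a : R) : usc_on D (fun=> a%:E).
Proof. by move=> z Dz c ac; apply: filterE. Qed.

Lemma usc_on_sum D (N : nat) (s : nat -> T -> \bar R) :
  (forall k z, D z -> (s k z <= 0)%E) -> (forall k, usc_on D (s k)) ->
  usc_on D (fun z => \sum_(k < N) s k z)%E.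
Proof.
move=> s0 us; elim: N => [|N IH].
  rewrite (_ : (fun _ => _) = fun=> 0%:E); first exact: usc_on_cst.
  by apply/funext => y; rewrite big_ord0.
rewrite (_ : (fun _ => _) = fun y => (\sum_(k < N) s k y + s N y)%E).
  apply: usc_on_add => // y Dy; rewrite (@le_lt_trans _ _ 0%E)// ?ltry ?s0//.
  by rewrite sume_le0// => *; exact: s0.
by apply/funext => y; rewrite big_ord_recr.
Qed.

Lemma usc_on_comp (S : topologicalType) (C : set S) D v (f : S -> T) :
  continuous f -> (forall z, C z -> D (f z)) -> usc_on D v ->
  usc_on C (v \o f).
Proof.
move=> cf CD uv z Cz a va; have := uv _ (CD z Cz) a va.
by rewrite !near_withinE => /(cf z); apply: (@filterS _ (nbhs z)) => y H Cy; exact/H/CD.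
Qed.

End UpperSemicontinuous.

Section Operations.
Context {R : realType} {V : normedModType (Cplx R)}.
Implicit Types (D : set V) (u v : V -> \bar R) (p b : V).

Lemma usc_on_continuous D (g : V -> R) : {within D, continuous g} ->
  usc_on D (EFin \o g).
Proof.
move=> /cts_within_nrmP cg z Dz a; rewrite lte_fin -subr_gt0 => /(cg z Dz)[r r0 rP].
apply/near_withinP; exists r => // y Dy /(rP y Dy); rewrite lte_fin => yz.
by have := ler_norm (g y - g z); lra.
Qed.

Lemma submean_le D u v p b : usc_on D u -> usc_on D v -> disc p b `<=` D ->
  (forall z, disc p b z -> (u z <= v z)%E) -> (v p <= u p)%E ->
  submean u p b -> submean v p b.
Proof.
move=> uu uv dD uv_le vu /(le_trans vu)/le_trans; apply.
apply: cmean_le; [exact: usc_circle_measurable uu dD|exact: usc_circle_measurable uv dD|].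
by move=> t _; exact/uv_le/disc_circle.
Qed.

Lemma submean_max D u v p b : usc_on D u -> usc_on D v -> disc p b `<=` D ->
  submean u p b -> submean v p b -> submean (fun z => maxe (u z) (v z)) p b.
Proof.
move=> uu uv dD su sv; have um := usc_on_max uu uv.
have [uvp|vup] := leP (u p) (v p).
  apply: (submean_le uv um dD) => //; last by rewrite max_r.
  by move=> z _; rewrite le_max lexx orbT.
apply: (submean_le uu um dD) => //; last by rewrite max_l// ltW.
by move=> z _; rewrite le_max lexx.
Qed.

Lemma submean_cst (a : R) p b : submean (fun=> a%:E) p b.
Proof. by rewrite /submean -[leLHS](@cmean_cst R). Qed.

Lemma submean_add D u v p b : usc_on D u -> usc_on D v -> disc p b `<=` D ->
  (forall z, D z -> (u z <= 0)%E) -> (forall z, D z -> (v z <= 0)%E) ->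
  submean u p b -> submean v p b -> submean (fun z => (u z + v z)%E) p b.
Proof.
move=> uu uv dD u0 v0 su sv; rewrite /submean cmeanD_le0//.
- exact: leeD.
- exact: usc_circle_measurable uu dD.
- exact: usc_circle_measurable uv dD.
- by move=> t; exact/u0/dD/disc_circle.
- by move=> t; exact/v0/dD/disc_circle.
Qed.

Lemma submean_scale D u (c : R) p b : 0 < c -> usc_on D u -> disc p b `<=` D ->
  (forall z, D z -> (u z <= 0)%E) ->
  submean u p b -> submean (fun z => (c%:E * u z)%E) p b.
Proof.
move=> c0 uu dD u0 su; rewrite /submean cmeanZ_le0 ?(ltW c0)//.
- by rewrite lee_pmul2l.
- exact: usc_circle_measurable uu dD.
- by move=> t; exact/u0/dD/disc_circle.
Qed.

End Operations.

Lemma sumN_le0 {R : realType} (f : nat -> \bar R) (N : nat) :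
  (forall k, (f k <= 0)%E) ->
  (\sum_(0 <= k < N) - f k = - \sum_(0 <= k < N) f k)%E.
Proof.
move=> f0; elim: N => [|N IH]; first by rewrite !big_geq ?oppe0.
rewrite !big_nat_recr//= IH oppeD// ltpinfty_adde_def// inE.
  by rewrite (@le_lt_trans _ _ 0%E)// ?ltry// sume_le0.
by rewrite (@le_lt_trans _ _ 0%E)// ltry.
Qed.

Section PSHOperations.
Context {R : realType} {n : nat}.
Local Notation V := 'rV[Cplx R]_n.+1.
Implicit Types (D : set V) (u v : V -> \bar R).

Lemma psh_max D u v : open D -> psh D u -> psh D v ->
  psh D (fun z => maxe (u z) (v z)).
Proof.
move=> oD /pshP-/(_ oD)[u1 u2 u3] /pshP-/(_ oD)[v1 v2 v3]; apply/pshP => //; split.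
- by move=> z Dz; rewrite gt_max u1 ?v1.
- exact: usc_on_max.
- move=> p b dD; exact: (submean_max u2 v2 dD (u3 p b dD) (v3 p b dD)).
Qed.

Lemma psh_scale D u (c : R) : open D -> 0 < c -> (forall z, D z -> (u z <= 0)%E) ->
  psh D u -> psh D (fun z => (c%:E * u z)%E).
Proof.
move=> oD c0 u0 /pshP-/(_ oD)[u1 u2 u3]; apply/pshP => //; split.
- move=> z Dz; apply: (@le_lt_trans _ _ 0%E); rewrite ?ltry//.
  by rewrite mule_ge0_le0 ?u0// lee_fin ltW.
- exact: usc_on_scale.
- move=> p b dD; exact: (submean_scale c0 u2 dD u0 (u3 p b dD)).
Qed.

Lemma psh_subr D u (c : R) : open D -> 0 <= c -> (forall z, D z -> (u z <= 0)%E) ->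
  psh D u -> psh D (fun z => (u z + (- c)%:E)%E).
Proof.
move=> oD c0 u0 /pshP-/(_ oD)[u1 u2 u3]; apply/pshP => //; split.
- by move=> z Dz; rewrite lte_add_pinfty ?u1// ltry.
- by apply: usc_on_add => //; [move=> *; rewrite ltry|exact: usc_on_cst].
- move=> p b dD; apply: (submean_add u2 _ dD u0 _ (u3 p b dD)); first exact: usc_on_cst.
    by move=> z _; rewrite lee_fin oppr_le0.
  exact: submean_cst.
Qed.

(** Nonpositivity makes the partial sums decrease, so that upper semicontinuity
    passes to the sum and monotone convergence applies to the means. *)
Lemma psh_series D (h : nat -> V -> \bar R) : open D ->
  (forall k z, D z -> (h k z <= 0)%E) -> (forall k, psh D (h k)) ->
  psh D (fun z => (- \sum_(0 <= k <oo) - h k z)%E).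
Proof.
move=> oD h0 hp; have nh0 k z : D z -> (0 <= - h k z)%E by move=> Dz; rewrite oppe_ge0 h0.
have uh k : usc_on D (h k) by case: (hp k).
apply/pshP => //; split.
- by move=> z Dz; rewrite (@le_lt_trans _ _ 0%E)// ?ltry// oppe_le0 nneseries_ge0// => *; exact: nh0.
- move=> z Dz a za.
  have [N Na] : exists N, (\sum_(0 <= k < N) h k z < a%:E)%E.
    apply: contrapT => noN; move: za; apply/negP; rewrite -leNgt leeNr.
    apply: lime_le; first by apply: is_cvg_nneseries => *; exact: nh0.
    near=> N; rewrite leNgt; apply/negP => Na; apply: noN; exists N.
    by rewrite -lteN2; move: Na; rewrite sumN_le0// => k; exact: h0.
  have uN : usc_on D (fun y => \sum_(0 <= k < N) h k y)%E.
    rewrite (_ : (fun _ => _) = fun y => (\sum_(k < N) h k y)%E).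
      by apply: usc_on_sum => // *; exact: h0.
    by apply/funext => y; rewrite big_mkord.
  have /near_withinP[r r0 rP] := uN z Dz a Na.
  apply/near_withinP; exists r => // y Dy yz; apply: le_lt_trans (rP y Dy yz).
  rewrite leeNl; apply: le_trans (nneseries_lim_ge N _); last by move=> *; exact: nh0.
  by rewrite sumN_le0// => k; exact: h0.
- move=> p b dD; have Dc t : D (p + cis t *: b) by exact/dD/disc_circle.
  have mh k := usc_circle_measurable (uh k) dD.
  rewrite /submean cmeanN; last first.
    by move=> t _; rewrite nneseries_ge0// => *; exact: nh0.
  rewrite cmean_nneseries; last 2 first.
  + by move=> k; exact: measurableT_comp.
  + by move=> k t; exact: nh0.
  rewrite leeN2; apply: lee_nneseries => [k _ _|k _].
    by apply: cmean_ge0 => t _; exact: nh0.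
  rewrite -[leLHS]oppeK -cmeanN; last by move=> t _; exact: nh0.
  rewrite leeN2 (_ : (fun _ => _) = fun t => h k (p + cis t *: b)); last first.
    by apply/funext => t; rewrite oppeK.
  by have /pshP-/(_ oD)[_ _] := hp k; apply.
Unshelve. all: by end_near. Qed.

End PSHOperations.

(** * From small circles to all circles *)

Section RiemannSums.
Context {R : realType}.
Local Notation mu := (@lebesgue_measure R).
Local Notation I2pi := `[0%R, (2 * pi)%R : R]%classic.
Implicit Types (F : R -> R).

Lemma itv_ucontinuous F (a c e : R) : continuous F -> 0 < e ->
  exists2 r : R, 0 < r &
    forall s t, a <= s <= c -> `|t - s| <= r -> `|F t - F s| <= e.
Proof.
move=> cF e0.
have := (compact_near_coveringP _).1 (@segment_compact R a c) R (0^'+)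
  (fun r s => forall t, `|t - s| <= r -> `|F t - F s| <= e) _.
case.
  move=> s _; have e2 : 0 < e / 2 by rewrite divr_gt0.
  have /cvgrPdist_lt/(_ _ e2)/nbhs_ballP[r /= r0 rP] := cF s.
  exists (ball s (r / 2), [set d | d < r / 2]).
    by split=> /=; [apply: nbhsx_ballx|apply: nbhs_right_lt]; rewrite divr_gt0.
  move=> [s' d] /= [+ dr] t ts'; rewrite /ball /= => ss'.
  have h1 : `|F s - F s'| < e / 2 by apply: rP; rewrite /ball /=; lra.
  have h2 : `|F s - F t| < e / 2.
    by apply: rP; rewrite /ball /=; have := ler_distD s' s t; rewrite (distrC s' t); lra.
  by have := ler_distD (F s) (F t) (F s'); rewrite (distrC (F t) (F s)); lra.
move=> d /= d0 dP; exists (d / 2); first by rewrite divr_gt0.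
have d2 : 0 < d / 2 by rewrite divr_gt0.
have db : ball_ Num.norm 0 d (d / 2) by rewrite /= sub0r normrN gtr0_norm//; lra.
move=> s t sac ts; apply: (dP (d / 2) db d2) => //=; by rewrite in_itv.
Qed.

Lemma riemann_sum_le_integral F (h e theta L : R) (j : nat) : continuous F ->
  0 < h -> 0 <= theta <= h -> j%:R * h <= L ->
  (forall s t, 0 <= s <= L -> `|t - s| <= h -> `|F t - F s| <= e) ->
  ((\sum_(k < j) h * (F (theta + k%:R * h) - e))%:E <=
    \int[mu]_(t in `[0%R, (j%:R * h)%R]) (F t)%:E)%E.
Proof.
move=> cF h0 th + Fe; have mF (S : set R) : measurable_fun S (EFin \o F).
  apply/measurable_EFinP; apply: measurable_funTS; exact: continuous_measurable_fun.
elim: j => [|j IH] jL.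
  by rewrite big_ord0 mul0r set_itv1 integral_set1.
have jhL : j%:R * h <= L by apply: le_trans jL; rewrite ler_pM2r// ler_nat.
have jh0 : 0 <= j%:R * h by rewrite mulr_ge0// ltW.
have jhS : j.+1%:R * h = j%:R * h + h by rewrite -natr1 mulrDl mul1r.
rewrite (_ : `[0, j.+1%:R * h]%classic =
    `[0%R, (j%:R * h)%R]%classic `|` `](j%:R * h)%R, (j.+1%:R * h)%R]%classic); last first.
  by rewrite -itv_bndbnd_setU// bnd_simp// jhS lerDl ltW.
rewrite integral_setU//; last 2 first.
- exact: mF.
- apply/disj_setPS => t [] /=; rewrite !in_itv /= => /andP[_ ta] /andP[tb _].
  by move: (lt_le_trans tb ta); rewrite ltxx.
rewrite big_ord_recr /= EFinD; apply: leeD; first exact: IH.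
have -> : (h * (F (theta + j%:R * h) - e))%:E =
    (\int[mu]_(t in `](j%:R * h)%R, (j.+1%:R * h)%R])
      cst (F (theta + j%:R * h) - e)%:E t)%E.
  rewrite integral_cst//= lebesgue_measure_itv /= lte_fin jhS ltrDl h0.
  by rewrite -EFinB -EFinM mulrC; congr (_ * _)%:E; rewrite addrAC subrr add0r.
apply: integral_le => // t; rewrite /= in_itv /= => /andP[t1 t2].
rewrite lee_fin; have /ler_normlP[_] : `|F (theta + j%:R * h) - F t| <= e.
  apply: Fe; first lra.
  by rewrite ler_norml; apply/andP; split; lra.
lra.
Qed.

(** Averages over equally spaced points are, whatever their starting point, at
    most the mean up to a modulus of continuity. *)
Lemma equidistributed_le_cmean F (x : R) : continuous F ->
  (forall t, F (t + 2 * pi) = F t) ->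
  (forall N : nat, (0 < N)%N -> exists2 theta, 0 <= theta &
     N%:R * x <= \sum_(k < N) F (theta + k%:R * (2 * pi / N%:R))) ->
  (x%:E <= cmean (EFin \o F))%E.
Proof.
move=> cF pF xF; have pi0 : 0 < 2 * pi :> R by rewrite mulr_gt0 ?pi_gt0.
apply/lee_addgt0Pr => e e0.
have [r r0 rP] := itv_ucontinuous 0 (2 * pi) cF e0.
have [N N0 Nr] : exists2 N : nat, (0 < N)%N & 2 * pi / N%:R <= r.
  exists (Num.trunc (2 * pi / r)).+1 => //.
  by rewrite ler_pdivrMr// [r * _]mulrC -ler_pdivrMr// ltW// truncnS_gt.
have N0' : 0 < N%:R :> R by rewrite ltr0n.
have [th th0 xth] := xF N N0.
set h := 2 * pi / N%:R in xth Nr; have h0 : 0 < h by rewrite divr_gt0.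
have Nh : N%:R * h = 2 * pi by rewrite mulrC /h divfK// gt_eqF.
(* The sum over all vertices has period [h], so the first vertex may be taken in
   the first interval of the subdivision. *)
pose S t := \sum_(k < N) F (t + k%:R * h).
have Sh t : S (t + h) = S t.
  rewrite /S; case: (N) N0 Nh => // M _ Nh'.
  rewrite big_ord_recr big_ord_recl /= addrC; congr (_ + _).
    by rewrite mul0r addr0 -[RHS]pF -Nh' -natr1; congr F; ring.
  apply: eq_bigr => k _; congr F; rewrite /bump /= -natr1; ring.
have Sj t (j : nat) : S (t + j%:R * h) = S t.
  elim: j => [|j IH]; first by rewrite mul0r addr0.
  by rewrite -natr1 mulrDl mul1r addrA Sh.
have thh : 0 <= th / h by rewrite divr_ge0// ltW.
pose th0' := th - (Num.trunc (th / h))%:R * h.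
have th0P : 0 <= th0' <= h.
  have /andP[t1 t2] := truncn_itv thh.
  move: t1 t2; rewrite ler_pdivlMr// ltr_pdivrMr// -natr1 mulrDl mul1r /th0' => *.
  by apply/andP; split; lra.
have Sth : S th = S th0' by rewrite -(Sj th0' (Num.trunc (th / h))) subrK.
have := @riemann_sum_le_integral F h e th0' (2 * pi) N cF h0 th0P _ _.
rewrite Nh lexx => /(_ isT) /(_ _) RS.
have {}RS : ((\sum_(k < N) h * (F (th0' + k%:R * h) - e))%:E <=
    \int[mu]_(t in I2pi) (F t)%:E)%E.
  by apply: RS => s t s0 ts; apply: rP => //; exact: le_trans ts Nr.
have : (((2 * pi)^-1 * (\sum_(k < N) h * (F (th0' + k%:R * h) - e)))%:E <=
    cmean (EFin \o F))%E.
  by rewrite EFinM lee_pmul2l// lte_fin invr_gt0.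
move=> /(le_trans _) H; rewrite -leeBlDr// -EFinB; apply: H; rewrite lee_fin.
rewrite -mulr_sumr sumrB sumr_const card_ord -/(S th0') -Sth -[e *+ N]mulr_natl.
rewrite mulrA /h mulrA mulVf ?gt_eqF// mul1r mulrC ler_pdivlMr//.
by rewrite mulrBl [x * _]mulrC [e * _]mulrC lerD2r.
Qed.

End RiemannSums.

Section LocalToGlobal.
Context {R : realType} {V : normedModType (Cplx R)}.
Implicit Types (D : set V) (v : V -> \bar R) (p b : V).

(** Gluing two functions preserves the submean inequality only on the circles too
    small to reach the seam. *)
Definition locally_submean D v := exists2 d : R, 0 < d &
  forall p b, nrm b < d -> disc p b `<=` D -> submean v p b.

Lemma cisD (s t : R) : cis (s + t) = cis s * cis t :> Cplx R.
Proof.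
rewrite /cis cosD sinD; apply/eqP; rewrite eq_complex /=.
by apply/andP; split; apply/eqP; ring.
Qed.

Lemma cis_2pi (t : R) : cis (t + 2 * pi) = cis t :> Cplx R.
Proof. by rewrite /cis mulr_natl cosD2pi sinD2pi. Qed.

Lemma unit_cis (l : Cplx R) : nrm l = 1 -> exists2 t : R, 0 <= t & l = cis t.
Proof.
case: l => x y; rewrite nrm_cplx /= => xy1.
have {}xy1 : x ^+ 2 + y ^+ 2 = 1.
  by rewrite -[LHS]sqr_sqrtr ?xy1 ?expr1n// addr_ge0 ?sqr_ge0.
have x1 : -1 <= x <= 1.
  by rewrite -ler_norml -(@expr_le1 _ 2)// real_normK ?num_real// -xy1 lerDl sqr_ge0.
have y2 : y ^+ 2 = 1 - x ^+ 2 by rewrite -xy1; ring.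
have ca : cos (acos x) = x by rewrite acosK// in_itv.
have pi0 := pi_gt0 R.
case: (leP 0 y) => y0.
  exists (acos x); first exact: acos_ge0.
  by rewrite /cis ca sin_acos// -y2 sqrtr_sqr ger0_norm.
exists (2 * pi - acos x); first by have := acos_lepi x1; lra.
rewrite -[RHS]cis_2pi (_ : _ + _ = - acos x + 2 * pi + 2 * pi); last by ring.
rewrite !cis_2pi /cis cosN sinN ca sin_acos// -y2 sqrtr_sqr ltr0_norm//.
by rewrite opprK.
Qed.

(** Passing from small circles to all circles.  Rotating a disc about its centre
    permutes the small circles, so averages of [v] over the rotations of the
    points of the disc by the [N]-th roots of unity obey the maximum principle;
    at the centre they give [v p], on the boundary they are averages of [v] over
    the vertices of regular [N]-gons.  A continuous majorant [P] makes the latter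
    converge to the mean of [P]. *)
Lemma locally_submean_le_cmean D v (P : V -> R) p b :
  usc_on D v -> (forall z, D z -> (v z <= 0)%E) -> locally_submean D v ->
  {within D, continuous P} -> (forall z, D z -> (v z <= (P z)%:E)%E) ->
  disc p b `<=` D -> (v p <= cmean (fun t => (P (p + cis t *: b))%:E))%E.
Proof.
move=> uv v0 [d d0 dv] cP vP dD.
have [vNoo|vNoo] := eqVneq (v p) -oo%E; first by rewrite vNoo leNye.
have [x vx] : exists x : R, v p = x%:E.
  have := v0 p (dD _ (disc_center p b)).
  by case: (v p) vNoo => // x _ _; exists x.
pose F (t : R) := P (p + cis t *: b).
have cF : continuous F.
  move=> t; have Dt := dD _ (disc_circle p b t).
  apply/cvgrPdist_lt => e e0.
  have [r r0 rP] := cts_within_nrmP cP Dt e0.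
  have /cvg_nrmP/(_ r r0) := @circle_continuous _ _ p b t.
  by apply: (@filterS _ (nbhs t)) => s sr; rewrite distrC rP//; exact/dD/disc_circle.
rewrite vx; apply: (equidistributed_le_cmean cF).
  by move=> t; rewrite /F cis_2pi.
move=> N N0; set h := 2 * pi / N%:R.
pose w (k : nat) : Cplx R := cis (k%:R * h).
pose Cd := [set l : Cplx R | nrm l <= 1].
pose f k (l : Cplx R) : V := p + (l * w k) *: b.
have wnrm k l : nrm (l * w k : Cplx R) = nrm l.
  by rewrite -[l * w k]/(l *: w k) nrmZ nrm_cis mulr1.
have fD k l : Cd l -> D (f k l).
  by move=> l1; apply: dD; exists (l * w k) => //=; rewrite wnrm.
pose s k l := v (f k l).
have fc k : continuous (f k).
  move=> l; apply/(@cvg_nrmP _ _ _ (nbhs l) _) => e e0; apply/(@near_nrmP R (Cplx R) l).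
  have b1 : 0 < nrm b + 1 by rewrite ltr_wpDl// nrm_ge0.
  exists (e / (nrm b + 1)); first by rewrite divr_gt0.
  move=> m ml; rewrite opprD addrACA subrr add0r -scalerBl -mulrBl nrmZ wnrm.
  move: ml; rewrite ltr_pdivlMr//; apply: le_lt_trans.
  by rewrite ler_wpM2l ?nrm_ge0// lerDl.
have us k : usc_on Cd (s k) by exact: (usc_on_comp (fc k) (fD k) uv).
have s0 k l : Cd l -> (s k l <= 0)%E by move=> /(fD k); exact: v0.
have uS : usc_on Cd (fun l => \sum_(k < N) s k l)%E by exact: usc_on_sum.
have S0 : (\sum_(k < N) s k 0%R = (N%:R * x)%:E)%E.
  rewrite (eq_bigr (fun=> x%:E)); last by move=> k _; rewrite /s /f mul0r scale0r addr0.
  by rewrite sumEFin sumr_const card_ord mulr_natl.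
have cCd : compact Cd.
  apply: (@compact_bounded_cplx _ _ 1) => //.
  apply: (@closed_comp _ _ (@nrm R (Cplx R)) [set y : R | y <= 1]).
    by move=> l _; exact: nrm_continuous.
  exact: closed_le.
have := @max_principle R (Cplx R) Cd [set l | nrm l < 1] _ 0 1 (oner_neq0 _) cCd uS.
case.
- move=> l l1; rewrite (@le_lt_trans _ _ 0%E)// ?ltry// sume_le0// => k _.
  exact: s0.
- move=> c /= c1; exists (Num.min (1 - nrm c) (d / (nrm b + 1))).
    by rewrite lt_min subr_gt0 c1 divr_gt0// ltr_wpDl// nrm_ge0.
  move=> g; rewrite lt_min => /andP[g1 g2].
  have dC : disc c g `<=` Cd.
    by move=> l /disc_nrm lc; rewrite /Cd /=; have := nrmB l c 0; rewrite !subr0; lra.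
  split=> //; rewrite /submean.
  rewrite (_ : (fun t => _) = fun t => \sum_(k < N) s k (c + cis t *: g)%R)%E//.
  rewrite (@cmean_sum_le0 _ N (fun k t => s k (c + cis t *: g))).
  + apply: lee_sum => k _.
    have fE l : f k (c + l *: g) = f k c + l *: ((g * w k) *: b).
      by rewrite /f -addrA scalerA -scalerDl; congr (_ + _ *: _); rewrite mulrDl mulrA.
    have nb : nrm ((g * w k) *: b) < d.
      have b1 : 0 < nrm b + 1 by rewrite ltr_wpDl// nrm_ge0.
      rewrite nrmZ wnrm; move: g2; rewrite ltr_pdivlMr//; apply: le_lt_trans.
      by rewrite ler_wpM2l ?nrm_ge0// lerDl.
    have dd : disc (f k c) ((g * w k) *: b) `<=` D.
      by move=> _ [l l1 <-]; rewrite -fE; apply: fD; apply: dC; exists l.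
    apply: le_trans (dv _ _ nb dd) _; rewrite le_eqVlt; apply/orP; left; apply/eqP.
    by apply: eq_cmean => t; rewrite -fE.
  + by move=> k; exact: (usc_circle_measurable (us k) dC).
  + by move=> k t; apply: s0; exact/dC/disc_circle.
- by rewrite /Cd /= nrm0.
- by rewrite S0 ltNyr.
move=> m [Cm nm]; rewrite S0 => Nm.
have m1 : nrm m = 1.
  by apply/eqP; rewrite eq_le Cm /= leNgt; apply/negP.
have [th th0 mth] := unit_cis m1.
exists th => //; rewrite -lee_fin; apply: (le_trans Nm).
rewrite -sumEFin; apply: lee_sum => k _; rewrite /s /F /f mth -cisD.
by apply: vP; apply: dD; exact: disc_circle.
Qed.

End LocalToGlobal.

(** * Walsh's envelope *)

Section Envelope.
Context {R : realType} {V : normedModType (Cplx R)}.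
Context (D : set V) (Phi G : V -> R).
Context (oD : open D).
Context (cD : compact (closure D)).
Context (cPhi : {within closure D, continuous Phi}).
Context (cG : {within closure D, continuous G}).
Context (sG : forall p b, disc p b `<=` D -> submean (EFin \o G) p b).
Context (GPhi : forall z, D z -> G z <= Phi z).
Context (Phi0 : forall z, D z -> Phi z <= 0).
Context (GPhi_bdry : forall z, closure D z -> ~ D z -> G z = Phi z).

Let subclD : D `<=` closure D. Proof. exact: subset_closure. Qed.

Definition competitor (v : V -> \bar R) :=
  [/\ usc_on D v, locally_submean D v & forall z, D z -> (v z <= (Phi z)%:E)%E].

Let uG : usc_on D (EFin \o G).
Proof.
by apply: usc_on_continuous; apply: continuous_subspaceW cG.
Qed.

Let competitor_G : competitor (EFin \o G).
Proof.
split; [by []| |by move=> z Dz /=; rewrite lee_fin GPhi].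
by exists 1 => // p b _; exact: sG.
Qed.

(** Walsh's translation argument.  In the collar of the boundary where [Phi] and
    [G] almost agree, a translate of [v] lowered by [e] lies below [G]; its
    maximum with [G], continued by [G] to the points whose translates leave [D],
    is therefore a competitor. *)
Lemma competitor_translate (e : R) : 0 < e -> exists2 r : R, 0 < r &
  forall h v, nrm h < r -> competitor v -> exists2 v', competitor v' &
    forall z, D z -> D (z + h) -> (v (z + h)%R - e%:E <= v' z)%E.
Proof.
move=> e0; have e2 : 0 < e / 2 by rewrite divr_gt0.
pose C := [set z | closure D z /\ e / 2 <= Phi z - G z].
have clC : closed C.
  move=> z cz.
  have cDz : closure D z.
    by apply: (closed_closure (A := D)); apply: closureS cz => y [].
  split=> //; rewrite leNgt; apply/negP => lt.
  pose d := (e / 2 - (Phi z - G z)) / 2.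
  have d0 : 0 < d by rewrite divr_gt0// subr_gt0.
  have [r1 r10 P1] := cts_within_nrmP cPhi cDz d0.
  have [r2 r20 P2] := cts_within_nrmP cG cDz d0.
  have [y [cDy Cy] yz] := (closure_nrmP _ _).1 cz (Num.min r1 r2) (ltac:(by rewrite lt_min r10)).
  move: yz; rewrite lt_min => /andP[/(P1 y cDy) + /(P2 y cDy)].
  rewrite !ltr_norml => /andP[_ +] /andP[+ _].
  by rewrite /d in d0 *; lra.
have CD : C `<=` D.
  move=> z [cz Cz]; apply: contrapT => nDz; move: Cz.
  by rewrite GPhi_bdry// subrr leNgt e2.
have cC : compact C by apply: (subclosed_compact clC cD) => z [].
have [eta eta0 etaP] : exists2 r : R, 0 < r & forall x y, C x -> nrm (y - x) < r -> D y.
  apply: compact_uniform_near cC _ => x /CD Dx.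
  by apply/near_nrmP; exact: open_nrmP.
have [r1 r10 uPhi] := compact_ucontinuous cD cPhi e2.
exists (Num.min (eta / 2) r1); first by rewrite lt_min r10 divr_gt0.
move=> h v; rewrite lt_min => /andP[h1 h2] [uv [d d0 dv] vPhi].
pose v' z := if `[< D (z + h) >] then maxe (v (z + h)%R - e%:E)%E (G z)%:E
             else (G z)%:E.
have Gv' z : ((G z)%:E <= v' z)%E.
  by rewrite /v'; case: ifP => // _; rewrite le_max lexx orbT.
have vsh z : D z -> D (z + h) -> (v (z + h)%R <= (Phi z + e / 2)%:E)%E.
  move=> Dz Dzh; apply: le_trans (vPhi _ Dzh) _; rewrite lee_fin.
  have := uPhi z (z + h) (subclD Dz) (subclD Dzh).
  by rewrite addrAC subrr add0r ltr_norml => /(_ h2)/andP[_]; lra.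
have vsh' z : D z -> D (z + h) -> (v (z + h)%R - e%:E <= (Phi z)%:E)%E.
  move=> Dz Dzh; rewrite leeBlDr//; apply: le_trans (vsh z Dz Dzh) _.
  by rewrite -EFinD lee_fin; lra.
have v'_out z : D z -> ~ C z -> v' z = (G z)%:E.
  move=> Dz nCz; rewrite /v'; case: ifP => // /asboolP Dzh; rewrite max_r//.
  rewrite leeBlDr//; apply: le_trans (vsh z Dz Dzh) _; rewrite -EFinD lee_fin.
  have : Phi z - G z < e / 2.
    by rewrite ltNge; apply/negP => ?; apply: nCz; split=> //; exact: subclD.
  lra.
have usv : usc_on [set z | D z /\ D (z + h)] (fun z => v (z + h)%R - e%:E)%E.
  apply: usc_on_add; last exact: usc_on_cst.
  - by move=> z [Dz Dzh]; rewrite (le_lt_trans (vsh z Dz Dzh))// ltry.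
  - by move=> *; rewrite -EFinN ltry.
  apply: (usc_on_comp (f := fun z => z + h) (D := D)) => //; last by move=> z [].
  by move=> z; apply: cvgD => //; exact: cvg_cst.
have uv' : usc_on D v'.
  move=> z Dz a; have [Dzh|nDzh] := pselect (D (z + h)).
    rewrite /v' asboolT// gt_max => /andP[va Ga].
    have /near_withinP[ra ra0 raP] := usv z (conj Dz Dzh) a va.
    have /near_withinP[rb rb0 rbP] := uG Dz Ga.
    have [rc rc0 rcP] := open_nrmP oD Dzh.
    apply/near_withinP; exists (Num.min ra (Num.min rb rc)).
      by rewrite !lt_min ra0 rb0.
    move=> y Dy; rewrite !lt_min => /and3P[ya yb yc].
    have Dyh : D (y + h) by apply: rcP; rewrite opprD addrACA subrr addr0.
    by rewrite asboolT// gt_max raP//= rbP.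
  have nCz : ~ C z.
    by move=> /etaP/(_ _); apply: contra_not nDzh; apply; rewrite addrAC subrr add0r; lra.
  rewrite v'_out// => /(uG Dz)/near_withinP[ra ra0 raP].
  have [d' d'0 d'P] := dist_closed_gt0 clC nCz.
  apply/near_withinP; exists (Num.min ra d'); first by rewrite lt_min ra0.
  move=> y Dy; rewrite lt_min => /andP[ya yd]; rewrite v'_out//; first exact: raP.
  by move=> /d'P; rewrite leNgt yd.
exists v'; last by move=> z Dz Dzh; rewrite /v' asboolT// le_max lexx.
split=> //.
- exists (Num.min (eta / 2) d); first by rewrite lt_min d0 divr_gt0.
  move=> p b; rewrite lt_min => /andP[b1 b2] dD.
  have Dp : D p := dD _ (disc_center p b).
  pose D1 := [set z | D z /\ D (z + h)].
  have [v'G|v'G] := eqVneq (v' p) (G p)%:E.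
    apply: (submean_le uG uv' dD); last exact: sG.
      by move=> z _; exact: Gv'.
    by rewrite v'G.
  have Cp : C p by apply: contrapT => /(v'_out p Dp)/eqP; apply/negP.
  have Dnear y : nrm (y - p) < eta -> D y by exact: etaP.
  have Dph : D (p + h) by apply: Dnear; rewrite addrAC subrr add0r; lra.
  have dDh : disc (p + h) b `<=` D.
    move=> y /disc_nrm yb; apply: Dnear.
    by have := nrmB y (p + h) p; rewrite (addrAC p) subrr add0r; lra.
  have dD1 : disc p b `<=` D1.
    move=> y yb; split; first exact: dD.
    apply: dDh; case: yb => l l1 <-; exists l => //; exact: addrAC.
  have uv'1 : usc_on D1 v'.
    move=> z [Dz _] a /(uv' z Dz a)/near_withinP[r r0 rP].
    by apply/near_withinP; exists r => // y [Dy _]; exact: rP.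
  apply: (@submean_le _ _ D1 (fun z => v (z + h)%R - e%:E)%E _ _ _ usv uv'1 dD1).
  + by move=> z /dD1[Dz Dzh]; rewrite /v' asboolT// le_max lexx.
  + move: v'G; rewrite /v' asboolT//; case: (leP (v (p + h)%R - e%:E)%E (G p)%:E) => _ //.
    by rewrite eqxx.
  + apply: (@submean_add _ _ D1 (fun z => v (z + h)%R) (fun=> (- e)%:E)) => //.
    * apply: (usc_on_comp (f := fun z => z + h) (D := D)) => //; last by move=> z [].
      by move=> z; apply: cvgD => //; exact: cvg_cst.
    * exact: usc_on_cst.
    * by move=> z [Dz Dzh]; rewrite (le_trans (vPhi _ Dzh))// lee_fin Phi0.
    * by move=> z _; rewrite lee_fin oppr_le0 ltW.
    * have := dv (p + h) b b2 dDh; rewrite /submean => /le_trans; apply.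
      rewrite le_eqVlt; apply/orP; left; apply/eqP; apply: eq_cmean => t.
      by rewrite (addrAC p).
    * exact: submean_cst.
- move=> z Dz; rewrite /v'; case: ifP => [/asboolP Dzh|_]; last by rewrite lee_fin GPhi.
  by rewrite ge_max vsh'//= lee_fin GPhi.
Qed.

Let Pe z := ereal_sup [set v z | v in competitor].

Let Pe_ge v z : competitor v -> (v z <= Pe z)%E.
Proof. by move=> Fv; apply: ereal_sup_ubound; exists v. Qed.

Let Pe_le z : D z -> (Pe z <= (Phi z)%:E)%E.
Proof. by move=> Dz; apply: ge_ereal_sup => _ [v [_ _ vPhi] <-]; exact: vPhi. Qed.

Let Pe_fin z : D z -> ((fine (Pe z))%:E = Pe z)%E.
Proof.
move=> Dz; have := Pe_le Dz; have := Pe_ge z competitor_G.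
by case: (Pe z).
Qed.

(** The upper envelope of the competitors is continuous before any upper
    semicontinuous regularization: translating a competitor costs only a small
    amount, uniformly in the competitor. *)
Lemma envelope_exists : exists P : V -> R,
  [/\ {within D, continuous P},
      forall p b, disc p b `<=` D -> submean (EFin \o P) p b,
      forall z, D z -> G z <= P z <= Phi z &
      forall v, competitor v -> forall z, D z -> (v z <= (P z)%:E)%E].
Proof.
exists (fun z => fine (Pe z)).
have transl e : 0 < e -> exists2 r : R, 0 < r & forall z y, D z -> D y ->
    nrm (y - z) < r -> fine (Pe y) <= fine (Pe z) + e.
  move=> e0; have [r r0 rP] := competitor_translate e0.
  exists r => // z y Dz Dy yz; rewrite -lee_fin EFinD !Pe_fin//.
  apply: ge_ereal_sup => _ [v Fv <-].
  have [v' Fv' vv'] := rP _ v yz Fv.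
  have := vv' z Dz; rewrite addrC subrK => /(_ Dy); rewrite leeBlDr// => /le_trans; apply.
  by rewrite leeD2r// Pe_ge.
have cP : {within D, continuous (fun z => fine (Pe z))}.
  apply/subspace_continuousP => z Dz; apply/cvgrPdist_le => e e0.
  have [r r0 rP] := transl e e0; apply/near_withinP; exists r => // y Dy yz.
  have h1 := rP z y Dz Dy yz; have h2 : fine (Pe z) <= fine (Pe y) + e.
    by apply: rP => //; rewrite nrmC.
  rewrite -[X in `|X|]/(fine (Pe z) - fine (Pe y)).
  by rewrite ler_norml; apply/andP; split; lra.
split=> //.
- move=> p b dD; have Dp := dD _ (disc_center p b).
  rewrite /submean /= Pe_fin//; apply: ge_ereal_sup => _ [v Fv <-].
  have [uv lv vPhi] := Fv.
  apply: (locally_submean_le_cmean uv _ lv cP) => //.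
    by move=> z Dz; rewrite (le_trans (vPhi z Dz))// lee_fin Phi0.
  by move=> z Dz; rewrite Pe_fin// Pe_ge.
- move=> z Dz; rewrite -!lee_fin Pe_fin// Pe_le// andbT.
  exact: Pe_ge competitor_G.
- by move=> v Fv z Dz; rewrite Pe_fin// Pe_ge.
Qed.

End Envelope.

(** * Test functions *)

Section BoundaryValues.
Context {R : realType} {V : normedModType (Cplx R)}.
Implicit Types (D K : set V) (u : V -> \bar R) (x : V).

Lemma ustar_NooP D u x : ustar D u x = -oo%E <->
  forall a : R, \forall z \near within D (nbhs x), (u z < a%:E)%E.
Proof.
split=> [ux a|ua].
  have : (ustar D u x < a%:E)%E by rewrite ux ltNyr.
  move=> /ereal_inf_lt[_ [S DS <-] Sa].
  apply: filterS DS => z Sz; apply: le_lt_trans Sa.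
  by apply: ereal_sup_ubound; exists z.
apply: eq_ninfty => a; apply: le_trans (ereal_inf_lbound _) _.
  by exists [set z | u z < a%:E]%E; [exact: ua|reflexivity].
by apply: ge_ereal_sup => _ [z /ltW za <-].
Qed.

Lemma ustar_not_Noo D u x (c : R) :
  (forall r : R, 0 < r -> exists2 p, D p & nrm (p - x) < r /\ (c%:E <= u p)%E) ->
  ustar D u x <> -oo%E.
Proof.
move=> H /ustar_NooP/(_ c)/near_withinP[r r0 rP].
have [p Dp [px cp]] := H r r0.
by have := rP p Dp px; rewrite ltNge cp.
Qed.

Lemma ustar_Noo_in D u x : usc_on D u -> D x -> ustar D u x = -oo%E <-> u x = -oo%E.
Proof.
move=> uu Dx; split=> [/ustar_NooP ux|ux].
  apply: eq_ninfty => a; apply/ltW.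
  by have := ux a; rewrite near_withinE => /nbhs_singleton; apply.
by apply/ustar_NooP => a; apply: uu => //; rewrite ux ltNyr.
Qed.

Lemma compact_lower_bound (C : set V) (g : V -> R) : compact C ->
  {within C, continuous g} -> exists c : R, forall z, C z -> c <= g z.
Proof.
move=> cC cg; have [[z0 Cz0]|nC] := pselect (C !=set0); last first.
  by exists 0 => z Cz; case: nC; exists z.
have cNg : {within C, continuous (fun z => - g z)}.
  by move=> z; apply: cvgN; exact: cg.
have [m Cm mP] := usc_attains_max cC (usc_on_continuous cNg) Cz0.
by exists (g m) => z /mP; rewrite lee_fin lerN2.
Qed.

Lemma continuous_cone x (d : R) : 0 < d ->
  continuous (fun y : V => - (nrm (y - x) / d)).
Proof.
move=> d0 y; apply/cvgrPdist_lt => e e0; apply/near_nrmP.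
exists (e * d); first by rewrite mulr_gt0.
move=> z; rewrite -ltr_pdivrMr// => zy; apply: le_lt_trans zy.
rewrite opprK addrC -mulrBl normrM [`|d^-1|]gtr0_norm ?invr_gt0// ler_pM2r ?invr_gt0//.
have h1 := nrmB y z x; have h2 := nrmB z y x; rewrite (nrmC y z) in h1.
by rewrite ler_norml; apply/andP; split; lra.
Qed.

Lemma dip_exists K (r : R) : 0 < r -> exists f : V -> R,
  [/\ continuous f, forall y, - 1 <= f y <= 0, forall y, K y -> f y = - 1 &
      forall y, f y != 0 -> exists2 x, K x & nrm (y - x) < r].
Proof.
move=> r0; pose S y := [set 0] `|` [set 1 - nrm (y - x) / r | x in K].
have S1 y : ubound (S y) 1.
  by move=> _ [->//|[x Kx <-]]; rewrite gerBl divr_ge0 ?nrm_ge0// ltW.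
have hS y : has_sup (S y) by split; [exists 0; left|exists 1].
exists (fun y => - sup (S y)).
have S0 y : 0 <= sup (S y) by apply: sup_upper_bound => //; left.
have Sle y z : sup (S y) <= sup (S z) + nrm (y - z) / r.
  apply: ge_sup; first by exists 0; left.
  move=> _ [->|[x Kx <-]]; first by rewrite addr_ge0 ?divr_ge0 ?nrm_ge0// ltW.
  have : 1 - nrm (z - x) / r <= sup (S z).
    by apply: sup_upper_bound => //; right; exists x.
  have := nrmB z y x; rewrite (nrmC z y) => H1 H2.
  have : nrm (z - x) / r <= (nrm (y - z) + nrm (y - x)) / r.
    by rewrite ler_pM2r// invr_gt0.
  by rewrite mulrDl; lra.
split.
- move=> y; apply/cvgrPdist_lt => e e0; apply/near_nrmP.
  exists (e * r); first by rewrite mulr_gt0.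
  move=> z; rewrite -ltr_pdivrMr// => zy; apply: le_lt_trans zy.
  have h1 := Sle y z; have h2 := Sle z y; rewrite (nrmC y z) in h1.
  by rewrite ler_norml; apply/andP; split; lra.
- move=> y; rewrite oppr_le0 S0 andbT lerN2.
  by apply: ge_sup; [exists 0; left|exact: S1].
- move=> y Ky; congr (- _); apply/eqP; rewrite eq_le; apply/andP; split.
    by apply: ge_sup; [exists 0; left|exact: S1].
  by apply: sup_upper_bound => //; right; exists y => //; rewrite subrr nrm0 mul0r subr0.
- move=> y; rewrite oppr_eq0; apply: contra_neqP => nK; apply/eqP; rewrite eq_le S0 andbT.
  apply: ge_sup; first by exists 0; left.
  move=> _ [->//|[x Kx <-]]; rewrite subr_le0 ler_pdivlMr// mul1r leNgt.
  by apply/negP => yx; apply: nK; exists x.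
Qed.

End BoundaryValues.

Section TestFunctions.
Context {R : realType} {n : nat}.
Local Notation V := 'rV[Cplx R]_n.+1.
Implicit Types (D K L : set V) (h u : V -> \bar R).

Lemma bounded_compact_closure D : bounded_set D -> compact (closure D).
Proof.
move=> /bounded_nrm[M DM]; apply: (@compact_bounded_rV _ _ _ M) => //.
exact: closed_closure.
Qed.

(** The sign of the boundary data passes to the extension by the maximum
    principle. *)
Lemma B_regular_extension D (f : V -> R) : B_regular D -> continuous f ->
  (forall z, f z <= 0) -> exists g : V -> R,
  [/\ psh D (EFin \o g), {within closure D, continuous g},
      forall z, closure D z -> ~ D z -> g z = f z &
      forall z, closure D z -> g z <= 0].
Proof.
move=> [[oD _ _ bD] Dext] cf f0.
have [g [pg cg gf]] := Dext f (continuous_subspaceT cf).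
have bE z : closure D z -> ~ D z -> bdry D z.
  by move=> cz nz; split=> //; rewrite (interior_id _).1.
exists g; split=> //; first by move=> z cz nz; apply: gf; exact: bE.
move=> z cz; have [_ _ sg] := (pshP _ oD).1 pg.
have ne1 : const_mx 1 != 0 :> V.
  by apply/eqP => /rowP/(_ ord0); rewrite !mxE => /eqP; rewrite oner_eq0.
have cD := bounded_compact_closure bD.
have := @max_principle R V (closure D) D (EFin \o g) z _ ne1 cD (usc_on_continuous cg).
case=> //.
- by move=> *; rewrite ltry.
- move=> y Dy; have [r r0 rP] := open_nrmP oD Dy; exists r => // b br.
  have dD : disc y b `<=` D by move=> q /disc_nrm qb; apply: rP; exact: le_lt_trans br.
  by split; [move=> q /dD; exact: subset_closure|exact: sg].
- by rewrite ltNyr.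
move=> m [cm nm]; rewrite lee_fin => /le_trans; apply.
by rewrite gf//; exact: bE.
Qed.

(** The candidates for the summands of the series: [- 2^-1] can be replaced by any
    negative bound, as infinitely many of them add up to [-oo]. *)
Definition test_function D K h :=
  [/\ psh D h, forall z, D z -> (h z <= 0)%E,
      exists c : R, forall z, D z -> (c%:E <= h z)%E &
      forall x, K x -> \forall z \near within D (nbhs x), (h z < (- 2^-1)%:E)%E].

Definition near_above D h (e : R) (x : V) :=
  \forall z \near within D (nbhs x), ((- e)%:E < h z)%E.

Lemma test_function_max D K h u : open D -> test_function D K h ->
  psh D u -> (forall z, D z -> (u z <= 0)%E) ->
  (forall x, K x -> \forall z \near within D (nbhs x), (u z < (- 2^-1)%:E)%E) ->
  test_function D K (fun z => maxe (h z) (u z)).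
Proof.
move=> oD [h1 h2 [c h3] h4] u1 u2 u4; split.
- exact: psh_max.
- by move=> z Dz; rewrite ge_max h2// u2.
- by exists c => z Dz; rewrite le_max h3.
- move=> x Kx; apply: filterS2 (h4 x Kx) (u4 x Kx) => z hz uz.
  by rewrite gt_max hz.
Qed.

Lemma test_function_cts D K (P Phi : V -> R) : open D -> compact (closure D) ->
  (forall x, K x -> closure D x) ->
  {within D, continuous P} -> (forall p b, disc p b `<=` D -> submean (EFin \o P) p b) ->
  {within closure D, continuous Phi} -> (forall z, D z -> P z <= Phi z) ->
  (forall z, D z -> P z <= 0) -> (forall x, K x -> Phi x <= - 1) ->
  (exists c, forall z, D z -> c <= P z) -> test_function D K (EFin \o P).
Proof.
move=> oD cD KD cP sP cPhi PPhi P0 K1 [c cPz]; split.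
- apply/pshP => //; split=> //; first by move=> *; rewrite ltry.
  exact: usc_on_continuous.
- by move=> z Dz; rewrite lee_fin P0.
- by exists c => z Dz; rewrite lee_fin cPz.
- move=> x Kx; have h0 : 0 < 2^-1 :> R by rewrite invr_gt0.
  have [r r0 rP] := cts_within_nrmP cPhi (KD x Kx) h0.
  apply/near_withinP; exists r => // z Dz zx.
  rewrite lte_fin; have := rP z (subset_closure Dz) zx.
  rewrite ltr_norml => /andP[_]; have := PPhi z Dz; have := K1 x Kx.
  have -> : (2^-1 = 1 / 2 :> R) by rewrite mul1r.
  by lra.
Qed.

Lemma near_above_cts D (P : V -> R) (e : R) C z : {within C, continuous P} ->
  D `<=` C -> C z -> - e < P z -> near_above D (EFin \o P) e z.
Proof.
move=> cP DC Cz ez; have d0 : 0 < P z + e by lra.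
have [r r0 rP] := cts_within_nrmP cP Cz d0.
apply/near_withinP; exists r => // y Dy yz; rewrite lte_fin.
by have := rP y (DC y Dy) yz; rewrite ltr_norml => /andP[+ _]; lra.
Qed.

(** The test function extends minus a multiple of the distance to [z]. *)
Lemma test_function_at_bdry D K z (e : R) : B_regular D -> closed K ->
  (forall x, K x -> closure D x /\ ~ D x) -> closure D z -> ~ D z -> ~ K z -> 0 < e ->
  exists2 h, test_function D K h & near_above D h e z.
Proof.
move=> BD clK KD cz nDz nKz e0.
have [d d0 dK] := dist_closed_gt0 clK nKz.
have [oD _ _ bD] := BD.1; have cD := bounded_compact_closure bD.
pose f (y : V) := - (nrm (y - z) / d).
have cf : continuous f by exact: continuous_cone.
have f0 y : f y <= 0 by rewrite oppr_le0 divr_ge0 ?nrm_ge0// ltW.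
have [g [pg cg gf g0]] := B_regular_extension BD cf f0.
exists (EFin \o g).
  have sDc : D `<=` closure D by exact: subset_closure.
  have [_ _ sg] := (pshP _ oD).1 pg.
  apply: (test_function_cts oD cD _ (continuous_subspaceW sDc cg) sg cg).
  - by move=> x /KD[].
  - by move=> y _.
  - by move=> y /sDc/g0.
  - move=> x Kx; have [cx nx] := KD x Kx; rewrite gf// /f lerN2.
    by rewrite ler_pdivlMr// mul1r dK.
  - have [c cP] := compact_lower_bound cD cg.
    by exists c => y /subset_closure; exact: cP.
apply: (near_above_cts cg (@subset_closure _ D) cz).
by rewrite gf// /f subrr nrm0 mul0r oppr0 oppr_lt0.
Qed.

Lemma scaled_ustar_Noo D K u (c : R) : 0 < c ->
  (forall x, K x -> ustar D u x = -oo%E) -> forall x, K x -> forall a : R,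
  \forall z \near within D (nbhs x), (c%:E * u z < a%:E)%E.
Proof.
move=> c0 uK x /uK/ustar_NooP/(_ _) H a; apply: filterS (H (a / c)) => z.
by rewrite EFinM lte_pdivlMr// muleC.
Qed.

Lemma small_multiple_above u (s : seq V) (e : R) : 0 < e ->
  (forall p, p \in s -> (u p <= 0)%E /\ u p <> -oo%E) ->
  exists2 c : R, 0 < c & forall p, p \in s -> ((- e)%:E < c%:E * u p)%E.
Proof.
move=> e0; elim: s => [|q s IH] us; first by exists 1.
have [p ps|c c0 cP] := IH; first by apply: us; rewrite inE ps orbT.
have [q0 qoo] := us q (mem_head _ _).
have [t ut t0] : exists2 t : R, u q = t%:E & t <= 0.
  by move: q0 qoo; case: (u q) => [t| |]// t0 _; exists t.
pose c' := e / (2 * (`|t| + 1)).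
have t1 : 0 < `|t| + 1 by rewrite ltr_wpDl.
have c'0 : 0 < c' by rewrite divr_gt0// mulr_gt0.
exists (Num.min c c'); first by rewrite lt_min c0.
have m0 : 0 < Num.min c c' by rewrite lt_min c0.
have scale_le (d d' : R) p : d <= d' -> (u p <= 0)%E /\ u p <> -oo%E ->
    (d'%:E * u p <= d%:E * u p)%E.
  move=> dd'; case: (u p) => [t'| |] [] //; rewrite lee_fin => t'0 _.
  by rewrite -!EFinM lee_fin ler_wnM2r.
move=> p; rewrite inE => /orP[/eqP ->|ps].
  apply: lt_le_trans (scale_le _ c' _ _ (conj q0 qoo)); last by rewrite ge_min lexx orbT.
  rewrite ut -EFinM lte_fin /c' ler0_norm// mulrAC ltr_pdivlMr.
    by nra.
  by rewrite mulr_gt0//; lra.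
apply: lt_le_trans (cP p ps) (scale_le _ c _ _ _); first by rewrite ge_min lexx.
exact: us p (mem_behead (s := q :: s) ps).
Qed.

(** At an interior point where some [u] with boundary values [-oo] on [K] is
    finite, a small multiple of [u] would do if it were continuous.  Walsh's
    envelope lies above this multiple, is continuous, and still has boundary
    values [- 1] on [K]. *)
Lemma test_function_at_interior D K u z (e : R) : B_regular D -> compact K ->
  (forall x, K x -> closure D x /\ ~ D x) ->
  psh D u -> (forall z, D z -> (u z <= 0)%E) -> (forall x, K x -> ustar D u x = -oo%E) ->
  D z -> u z <> -oo%E -> 0 < e ->
  exists2 h, test_function D K h & near_above D h e z.
Proof.
move=> BD cK KD pu u0 uK Dz uz e0.
have [oD _ _ bD] := BD.1; have cD := bounded_compact_closure bD.
have [c c0 cu] : exists2 c : R, 0 < c & ((- e)%:E < c%:E * u z)%E.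
  have [|c c0 cP] := @small_multiple_above u [:: z] e e0.
    by move=> p; rewrite inE => /eqP ->; split; first exact: u0.
  by exists c => //; apply: cP; rewrite mem_head.
pose q y := (c%:E * u y)%E.
have pq : psh D q by exact: psh_scale.
have q0 y : D y -> (q y <= 0)%E.
  by move=> Dy; rewrite mule_ge0_le0 ?u0// lee_fin ltW.
have [r r0 rP] : exists2 r : R, 0 < r & forall x y, K x -> nrm (y - x) < r ->
    (D y -> (q y < (- 1)%:E)%E).
  apply: (compact_uniform_near cK (P := fun y => D y -> (q y < (- 1)%:E)%E)) => x Kx.
  by have := scaled_ustar_Noo c0 uK Kx (- 1); rewrite near_withinE.
have [f [cf f01 fK fr]] := dip_exists K r0.
have f0 y : f y <= 0 by have /andP[] := f01 y.
have qf y : D y -> (q y <= (f y)%:E)%E.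
  move=> Dy; have [->|/fr[x Kx yx]] := eqVneq (f y) 0; first exact: q0.
  apply: (le_trans (ltW (rP x y Kx yx Dy))); rewrite lee_fin.
  by have /andP[] := f01 y.
have [G [pG cG Gf G0]] := B_regular_extension BD cf f0.
pose Phi y := Num.max (f y) (G y).
have cPhi : {within closure D, continuous Phi}.
  by apply: max_fun_continuous => //; exact: continuous_subspaceT.
have [_ _ sG] := (pshP _ oD).1 pG.
have [|||P [cP sP GPPhi Pmax]] := @envelope_exists R V D Phi G oD cD cPhi cG sG.
- by move=> y _; rewrite le_max lexx orbT.
- by move=> y Dy; rewrite ge_max f0 G0//; exact: subset_closure.
- by move=> y cy ny; rewrite /Phi Gf// maxxx.
have [uq1 uq2 uq3] := (pshP _ oD).1 pq.
have qP y : D y -> (q y <= (P y)%:E)%E.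
  apply: Pmax; split=> //; first by exists 1 => // p b _; exact: uq3.
  by move=> x Dx; apply: le_trans (qf x Dx) _; rewrite lee_fin le_max lexx.
exists (EFin \o P).
  apply: (test_function_cts oD cD _ cP sP cPhi).
  - by move=> x /KD[].
  - by move=> y /GPPhi/andP[].
  - move=> y Dy; have /andP[_ /le_trans] := GPPhi y Dy; apply.
    by rewrite ge_max f0 G0//; exact: subset_closure.
  - by move=> x Kx; have [cx nx] := KD x Kx; rewrite /Phi Gf// maxxx fK.
  - have [c' cP'] := compact_lower_bound cD cG.
    exists c' => y Dy; have /andP[+ _] := GPPhi y Dy; apply: le_trans.
    by apply: cP'; exact: subset_closure.
apply: (near_above_cts cP (fun y Dy => Dy) Dz).
by rewrite -lte_fin; exact: lt_le_trans cu (qP z Dz).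
Qed.

(** Test functions are stable under maxima, so finitely many of them, one near
    each point of a finite subset of [L], combine into one. *)
Lemma test_function_on_compact D K L (e : R) : open D -> compact L ->
  (exists h, test_function D K h) ->
  (forall x, L x -> exists2 h, test_function D K h & near_above D h e x) ->
  exists2 h, test_function D K h & forall x, L x -> near_above D h e x.
Proof.
move=> oD cL [h0 th0] HL.
(* By stability under maxima, the sets of test functions above a given one form a
   filter, which turns the covering argument into near-covering compactness. *)
pose F := filter_from (test_function D K)
  (fun h => [set h' | test_function D K h' /\ forall z, D z -> (h z <= h' z)%E]).
have FF : Filter F.
  apply: filter_from_filter; first by exists h0.
  move=> h h' th th'; exists (fun z => maxe (h z) (h' z)).
    by case: th' => *; exact: test_function_max.
  move=> g [tg hg]; split; split=> // z /hg; rewrite ge_max => /andP[] //.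
have := (compact_near_coveringP _).1 cL _ F (fun h x => near_above D h e x) FF.
case=> [x Lx|h th hP]; last by exists h => //; apply: hP.
have [h th hx] := HL x Lx.
exists ([set y | near_above D h e y], [set h' | forall z, D z -> (h z <= h' z)%E]).
  split=> /=; last by exists h => // h' [].
  have /near_withinP[r r0 rP] := hx; apply/nbhs_nrmP; exists (r / 2).
    by rewrite divr_gt0.
  move=> y yx; apply/near_withinP; exists (r / 2); first by rewrite divr_gt0.
  by move=> z Dz zy; apply: rP => //; have := nrmB z y x; lra.
move=> [y h'] /= [/near_withinP[r r0 rP] hh']; apply/near_withinP; exists r => // z Dz zy.
exact: lt_le_trans (rP z Dz zy) (hh' z Dz).
Qed.

End TestFunctions.

(** * The series *)

Section Series.
Context {R : realType} {n : nat}.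
Local Notation V := 'rV[Cplx R]_n.+1.
Context (D : set V) (K L : nat -> set V) (Q : set V).
Context (oD : open D).
Context (QD : Q `<=` D).
Context (Q_dense : forall z (r : R), D z -> 0 < r -> exists2 y, Q y & nrm (y - z) < r).
Context (Q_neq0 : Q !=set0).
Context (K_incr : forall k, K k `<=` K k.+1).
Context (L_incr : forall k, L k `<=` L k.+1).
Context (cL : forall k, compact (L k)).
Context (LD : forall k, L k `<=` closure D).

Local Notation eps k := (2^-1 ^+ k : R).

Context (summand_exists : forall k (s : seq V), (forall p, p \in s -> Q p) ->
  exists h, [/\ test_function D (K k) h,
    forall p, p \in s -> ((- eps k)%:E < h p)%E &
    forall x, L k x -> near_above D h (eps k) x]).

Let eps_gt0 k : 0 < eps k. Proof. by rewrite exprn_gt0// invr_gt0. Qed.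

Let eps_sum (N : nat) : \sum_(i < N) eps i <= 2.
Proof.
suff -> : \sum_(i < N) eps i = 2 - 2 * eps N by rewrite gerBl mulr_ge0// ltW.
elim: N => [|N IH]; first by rewrite big_ord0 expr0 mulr1 subrr.
by rewrite big_ord_recr /= IH exprS; field.
Qed.

Let L_mono i k : (i <= k)%N -> L i `<=` L k.
Proof.
move=> /subnK <-; elim: (k - i)%N => [//|j IH]; rewrite addSn.
by move=> x /IH; exact: L_incr.
Qed.

Let K_mono i k : (i <= k)%N -> K i `<=` K k.
Proof.
move=> /subnK <-; elim: (k - i)%N => [//|j IH]; rewrite addSn.
by move=> x /IH; exact: K_incr.
Qed.

(** The functions [g j] with [j < i] are left out because they need not be close
    to zero near [L i]. *)
Let controls k (g : nat -> V -> \bar R) i (s : seq V) := forall x, L i x ->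
  exists2 p, p \in s & nrm (p - x) < k.+1%:R^-1 /\
    forall j, (i <= j < k)%N -> ((- eps j)%:E < g j p)%E.

(** Each of the finitely many [g j] concerned is above [- eps j] near a point of
    [L i]; points of [Q] are found there by density, finitely many by compactness. *)
Let controls_exists1 k g i :
  (forall j, (i <= j < k)%N -> forall x, L j x -> near_above D (g j) (eps j) x) ->
  exists2 s, forall p, p \in s -> Q p & controls k g i s.
Proof.
move=> gL; pose F := filter_from [set s : seq V | forall p, p \in s -> Q p]
  (fun s => [set s' : seq V | (forall p, p \in s' -> Q p) /\ {subset s <= s'}]).
have FF : Filter F.
  apply: filter_from_filter; first by exists [::].
  move=> s s' /= Qs Qs'; exists (s ++ s').
    by move=> p; rewrite /= mem_cat => /orP[/Qs|/Qs'].
  move=> t [Qt st]; split; split=> // p ps; apply: st; rewrite mem_cat ps ?orbT//.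
have k0 : 0 < k.+1%:R^-1 :> R by rewrite invr_gt0.
have := (compact_near_coveringP _).1 (@cL i) _ F (fun s x =>
  exists2 p, p \in s & nrm (p - x) < k.+1%:R^-1 /\
    forall j, (i <= j < k)%N -> ((- eps j)%:E < g j p)%E) FF.
case=> [x Lx|s Qs sP]; last first.
  by exists s => // x Lx; exact: (sP s (conj Qs (fun _ => id)) x Lx).
have [r r0 rP] : exists2 r : R, 0 < r & forall p, D p -> nrm (p - x) < r ->
    forall j, (i <= j < k)%N -> ((- eps j)%:E < g j p)%E.
  suff : \forall p \near within D (nbhs x), forall j, (i <= j < k)%N ->
      ((- eps j)%:E < g j p)%E by move=> /near_withinP.
  have : forall m, \forall p \near within D (nbhs x), forall j, (j < m)%N ->
      (i <= j < k)%N -> ((- eps j)%:E < g j p)%E.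
    elim=> [|m IH]; first by apply: filterE.
    have [ijk|nijk] := boolP (i <= m < k)%N; last first.
      apply: filterS IH => p H j; rewrite ltnS leq_eqVlt => /orP[/eqP -> ijk|]; last exact: H.
      by move: nijk; rewrite ijk.
    have Lmx : L m x by apply: L_mono Lx; case/andP: ijk.
    apply: filterS2 IH (gL m ijk x Lmx) => p H Hm j.
    by rewrite ltnS leq_eqVlt => /orP[/eqP -> //|]; exact: H.
  move=> /(_ k); apply: filterS => p H j ijk; apply: H => //; by case/andP: ijk.
pose d := Num.min (k.+1%:R^-1 / 2) r.
have d0 : 0 < d by rewrite lt_min r0 divr_gt0.
have d20 : 0 < d / 2 by rewrite divr_gt0.
have [y Dy yx] := (closure_nrmP _ _).1 (LD Lx) _ d20.
have [p Qp py] := Q_dense Dy d20.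
have px : nrm (p - x) < d by have := nrmB p y x; lra.
have px1 : nrm (p - x) < k.+1%:R^-1 / 2 by move: px; rewrite lt_min => /andP[].
have px2 : nrm (p - x) < r by move: px; rewrite lt_min => /andP[].
exists ([set x' | nrm (x' - x) < k.+1%:R^-1 / 2], [set s : seq V | {subset [:: p] <= s}]).
  split=> /=; first by apply/nbhs_nrmP; exists (k.+1%:R^-1 / 2) => //; rewrite divr_gt0.
  by exists [:: p] => [q|s []//]; rewrite /= inE => /eqP ->.
move=> [x' s] /= [x'x ps]; exists p; first by apply: ps; rewrite inE.
split; first by have := nrmB p x x'; rewrite (nrmC x x'); move: px1 x'x; move: (k.+1%:R^-1) => c; lra.
by apply: rP => //; exact: QD.
Qed.

Let controls_exists k (g : nat -> V -> \bar R) : exists s, (forall p, p \in s -> Q p) /\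
  ((forall j, (j < k)%N -> forall x, L j x -> near_above D (g j) (eps j) x) ->
   forall i, (i <= k)%N -> controls k g i s).
Proof.
have [gL|ngL] := pselect (forall j, (j < k)%N ->
    forall x, L j x -> near_above D (g j) (eps j) x); last first.
  by exists [::]; split=> // /ngL.
suff [s Qs sP] : exists2 s, forall p, p \in s -> Q p &
    forall i, (i < k.+1)%N -> controls k g i s by exists s; split.
elim: k.+1 => [|m [s Qs IH]]; first by exists [::].
have [t Qt tP] := @controls_exists1 k g m (fun j jk => gL j (andP jk).2).
exists (s ++ t) => [p|i]; first by rewrite mem_cat => /orP[/Qs|/Qt].
rewrite ltnS leq_eqVlt => /orP[/eqP ->|im] x Lx.
  by have [p pt H] := tP x Lx; exists p => //; rewrite mem_cat pt orbT.
by have [p ps H] := IH i im x Lx; exists p => //; rewrite mem_cat ps.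
Qed.

(** The summands are chosen one after the other, along with finite sets of
    points of [Q]: a point put into the set at stage [k], where the previous
    summands are under control, binds all the later ones. *)
Let summands_exist : exists (h : nat -> V -> \bar R) (s : nat -> seq V),
  [/\ forall k, test_function D (K k) (h k),
      forall k x, L k x -> near_above D (h k) (eps k) x,
      forall k p, p \in s k -> D p /\ forall j, (k <= j)%N -> ((- eps j)%:E < h j p)%E,
      exists p, p \in s 0%N &
      forall k i, (i <= k)%N -> controls k h i (s k)].
Proof.
have /choice[H HP] : forall ks : nat * seq V, exists h, (forall p, p \in ks.2 -> Q p) ->
    [/\ test_function D (K ks.1) h,
        forall p, p \in ks.2 -> ((- eps ks.1)%:E < h p)%E &
        forall x, L ks.1 x -> near_above D h (eps ks.1) x].
  move=> [k s] /=; have [Qs|nQs] := pselect (forall p, p \in s -> Q p).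
    by have [h hP] := summand_exists k Qs; exists h.
  by exists (fun=> 0%E) => /nQs.
have /choice[N NP] := fun kg : nat * (nat -> V -> \bar R) => controls_exists kg.1 kg.2.
have [q0 Qq0] := Q_neq0.
(* Stage [k] enlarges the finite set before it chooses the summand of index [k];
   the functions of index [k] or more are not chosen yet, and equal to zero. *)
pose fix st k : seq V * (nat -> V -> \bar R) := match k with
  | 0%N => ([:: q0], fun _ _ => 0%E)
  | k.+1 => let t := N (k, (st k).2) ++ (st k).1 in
            (t, fun i => if i == k then H (k, t) else (st k).2 i)
  end.
pose t k := (st k.+1).1; pose h k := (st k.+1).2 k.
have hE k : h k = H (k, t k) by rewrite /h /= eqxx.
have stE k i : (i < k)%N -> (st k).2 i = h i.
  elim: k => // k IH; rewrite ltnS leq_eqVlt => /orP[/eqP ->//|ik].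
  by rewrite /= (ltn_eqF ik) IH.
have Qst k p : p \in (st k).1 -> Q p.
  elim: k p => [|k IH] p; first by rewrite /= inE => /eqP ->.
  by rewrite /= mem_cat => /orP[|/IH//]; apply: (NP (k, (st k).2)).1.
have hP k : [/\ test_function D (K k) (h k),
        forall p, p \in t k -> ((- eps k)%:E < h k p)%E &
        forall x, L k x -> near_above D (h k) (eps k) x].
  by rewrite hE; apply: (HP (k, t k)) => p /=; exact: (Qst k.+1).
have t_mono k j : (k <= j)%N -> {subset t k <= t j}.
  move=> /subnK <-; elim: (j - k)%N => [//|m IH]; rewrite addSn => p /IH pt.
  by rewrite /t /= mem_cat; apply/orP; right; exact: pt.
exists h, t; split.
- by move=> k; case: (hP k).
- by move=> k; case: (hP k).
- move=> k p pk; split; first by apply/QD/(Qst k.+1).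
  by move=> j kj; have [_ + _] := hP j; apply; exact: t_mono pk.
- by exists q0; rewrite /t /= mem_cat [X in _ || X]inE eqxx orbT.
- move=> k i ik x Lx.
  have [_ /(_ _)] := NP (k, (st k).2); rewrite /= => NPk.
  have [|p pN [px pg]] := NPk _ i ik x Lx.
    by move=> j jk y Ly; rewrite stE//; case: (hP j) => _ _; exact.
  exists p; first by rewrite /t /= mem_cat pN.
  by split=> // j /andP[ij jk]; rewrite -(stE k)//; apply: pg; rewrite ij.
Qed.

(** At a point of [K k] the partial sums have arbitrarily low boundary values, and
    the sum lies below them.  At a point of [L k] the sum is bounded below along
    points of the finite sets, where the terms from index [k] on are at least
    those of a convergent geometric series. *)
Lemma series_construction : exists u : V -> \bar R,
  [/\ psh D u, forall z, D z -> (u z <= 0)%E, nontrivial D u,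
      forall k x, K k x -> ustar D u x = -oo%E &
      forall k x, L k x -> ustar D u x <> -oo%E].
Proof.
have [h [s [th hL hs s0 sL]]] := summands_exist.
have h0 k z : D z -> (h k z <= 0)%E by case: (th k) => _ + _ _; apply.
have nh0 k z : D z -> (0 <= - h k z)%E by move=> Dz; rewrite oppe_ge0 h0.
pose u z := (- \sum_(0 <= k <oo) - h k z)%E.
have u_le N z : D z -> (u z <= \sum_(0 <= k < N) h k z)%E.
  move=> Dz; rewrite /u leeNl; apply: le_trans (nneseries_lim_ge N _); last first.
    by move=> *; exact: nh0.
  by rewrite sumN_le0// => k; exact: h0.
have u_ge (e : nat -> R) (B : R) z : D z -> (forall N, \sum_(i < N) e i <= B) ->
    (forall i, ((- e i)%:E <= h i z)%E) -> ((- B)%:E <= u z)%E.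
  move=> Dz eB eh; rewrite /u EFinN leeN2; apply: lime_le.
    by apply: is_cvg_nneseries => *; exact: nh0.
  apply: nearW => N; apply: (@le_trans _ _ (\sum_(i < N) e i)%:E); last by rewrite lee_fin.
  rewrite big_mkord -sumEFin; apply: lee_sum => i _.
  by rewrite leeNl -EFinN.
exists u; split.
- by apply: psh_series => // k; case: (th k).
- move=> z Dz; rewrite (le_trans (u_le 0%N z Dz))// big_geq//.
- have [p ps] := s0.
  have [Dp hp] := hs 0%N p ps; exists p => //.
  apply/eqP => up; have := u_ge (fun i => eps i) 2 p Dp eps_sum (fun i => ltW (hp i isT)).
  by rewrite up leeNy_eq.
- move=> k x Kx; apply/ustar_NooP => a.
  have partial N : \forall z \near within D (nbhs x),
      (\sum_(0 <= i < k + N) h i z <= (- (N%:R / 2))%:E)%E.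
    elim: N => [|N IH].
      rewrite addn0 mul0r oppr0 near_withinE; apply: nearW => z Dz.
      by apply: sume_le0 => i _; exact: h0.
    have [_ _ _ /(_ x (K_mono (leq_addr N k) Kx)) hN] := th (k + N)%N.
    apply: filterS2 IH hN => z zN1 zN2; rewrite addnS big_nat_recr//=.
    apply: le_trans (leeD zN1 (ltW zN2)) _.
    by rewrite -EFinD lee_fin -[in leRHS]natr1; lra.
  have [N aN] : exists N : nat, - (N%:R / 2) < a.
    exists (Num.trunc (2 * `|a|)).+1.
    have := truncnS_gt (2 * `|a|); have := ler_norm (- a); rewrite normrN.
    by move: ((Num.trunc (2 * `|a|)).+1%:R) => *; lra.
  have := partial N; rewrite !near_withinE; apply: filterS => z zN Dz.
  by apply: le_lt_trans (u_le _ z Dz) (le_lt_trans (zN Dz) _); rewrite lte_fin.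
- move=> k x Lx.
  have /choice[c cP] : forall i, exists c : R, 0 <= c /\ forall z, D z -> ((- c)%:E <= h i z)%E.
    move=> i; have [_ _ [c cP] _] := th i; exists `|c|; split=> // z Dz.
    by apply: le_trans (cP z Dz); rewrite lee_fin lerNl -normrN ler_norm.
  pose e i : R := (if (i < k)%N then c i else 0) + eps i.
  apply: (@ustar_not_Noo _ _ _ _ _ (- (\sum_(i < k) c i + 2))) => r r0.
  (* A stage late enough for its points to be [r]-close to [L k]. *)
  pose m := maxn k (Num.trunc r^-1).
  have mr : m.+1%:R^-1 < r.
    rewrite invf_plt ?posrE//; apply: lt_le_trans (truncnS_gt _) _.
    by rewrite ler_nat ltnS leq_maxr.
  have [p ps [px pm]] := sL m k (leq_maxl _ _) x Lx.
  have [Dp hp] := hs m p ps; exists p => //; split; first exact: lt_trans mr.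
  apply: (u_ge e) => // [N|i].
    rewrite /e big_split /= lerD ?eps_sum//.
    pose c' i := if (i < k)%N then c i else 0.
    have c'0 i : 0 <= c' i by rewrite /c'; case: ifP => // _; case: (cP i).
    apply: (@le_trans _ _ (\sum_(0 <= i < k + N) c' i)).
      rewrite -(big_mkord xpredT c') (@big_cat_nat _ _ _ N 0 (k + N))//= ?leq_addl//.
      by rewrite lerDl sumr_ge0.
    rewrite (@big_cat_nat _ _ _ k 0 (k + N))//= ?leq_addr// [X in _ + X]big1_seq ?addr0.
      by rewrite big_mkord; apply: ler_sum => i _; rewrite /c' ltn_ord.
    by move=> i /andP[_]; rewrite mem_index_iota => /andP[ki _]; rewrite /c' ltnNge ki.
  rewrite /e; case: ltnP => ik.
    by apply: le_trans ((cP i).2 p Dp); rewrite lee_fin lerN2 lerDl ltW.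
  rewrite add0r; apply/ltW; case: (ltnP i m) => im; last exact: hp.
  by apply: pm; rewrite ik.
Qed.

End Series.

(** * Completely b-pluripolar sets and hulls *)

Section Exhaustion.
Context {R : realType} {n : nat}.
Local Notation V := 'rV[Cplx R]_n.+1.
Implicit Types (D A K L : set V) (u : V -> \bar R).

Lemma closed_exhaustion (T : topologicalType) (F : nat -> set T) :
  (forall i, closed (F i)) -> exists K : nat -> set T,
  [/\ forall k, closed (K k), forall k, K k `<=` K k.+1,
      forall i, F i `<=` K i & forall k, K k `<=` \bigcup_i F i].
Proof.
move=> cF; exists (fun k => \big[setU/set0]_(i < k.+1) F i); split.
- by move=> k; apply: closed_bigsetU => i _; exact: cF.
- by move=> k; rewrite [X in _ `<=` X]big_ord_recr /=; exact: subsetUl.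
- by move=> i; rewrite big_ord_recr /=; exact: subsetUr.
- by move=> k; rewrite -bigcup_mkord => x [i _ Fx]; exists i.
Qed.

Lemma bdryE D : open D -> bdry D = [set z | closure D z /\ ~ D z].
Proof. by move=> oD; rewrite /bdry (interior_id _).1. Qed.

(** The single function [u] serves the points of [s], where it is finite, through
    a small multiple; near the boundary points of [L] it may be [-oo], and the
    continuous test functions given by B-regularity take over. *)
Lemma boundary_summand D A K L u (s : seq V) (e : R) : B_regular D ->
  A `<=` bdry D -> psh D u -> (forall z, D z -> (u z <= 0)%E) -> nontrivial D u ->
  (forall x, A x -> ustar D u x = -oo%E) -> compact K -> K `<=` A ->
  compact L -> L `<=` bdry D `\` A -> 0 < e ->
  (forall p, p \in s -> D p /\ u p <> -oo%E) ->
  exists h, [/\ test_function D K h, forall p, p \in s -> ((- e)%:E < h p)%E &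
    forall x, L x -> near_above D h e x].
Proof.
move=> BD AD pu u0 [z0 Dz0 uz0] uA cK KA cL LA e0 us.
have [oD _ _ bD] := BD.1; rewrite bdryE// in AD LA.
have KD x : K x -> closure D x /\ ~ D x by move=> /KA/AD.
have uK x : K x -> ustar D u x = -oo%E by move=> /KA/uA.
have clK : closed K by apply: compact_closed => //; exact: norm_hausdorff.
have ex : exists h, test_function D K h.
  have [h th _] := test_function_at_interior BD cK KD pu u0 uK Dz0 (elimN eqP uz0) e0.
  by exists h.
have [h th hL] : exists2 h, test_function D K h & forall x, L x -> near_above D h e x.
  apply: test_function_on_compact => // x /LA[[cx nx] nAx].
  by apply: test_function_at_bdry => // /KA.
have [c c0 cs] : exists2 c : R, 0 < c & forall p, p \in s -> ((- e)%:E < c%:E * u p)%E.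
  by apply: small_multiple_above => // p /us[Dp up]; split=> //; exact: u0.
exists (fun z => maxe (h z) (c%:E * u z)%E); split.
- apply: test_function_max => //; first exact: psh_scale.
    by move=> z Dz; rewrite mule_ge0_le0 ?u0// lee_fin ltW.
  by move=> x Kx; exact: scaled_ustar_Noo c0 uK x Kx _.
- by move=> p ps; rewrite lt_max cs ?orbT.
- by move=> x Lx; apply: filterS (hL x Lx) => z; rewrite lt_max => ->.
Qed.

Lemma sub_b_hull D A : A `<=` bdry D -> A `<=` b_hull D A.
Proof. by move=> AD z Az; split=> [|u _ _ _]; [case: (AD z Az)|exact]. Qed.

(** Different points off the hull come with different functions that are finite
    there; compactness merges the test functions obtained from them. *)
Lemma hull_summand D A K L w (s : seq V) (e : R) : B_regular D ->
  A `<=` bdry D -> psh D w -> (forall z, D z -> (w z <= 0)%E) -> nontrivial D w ->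
  (forall x, A x -> ustar D w x = -oo%E) -> compact K -> K `<=` A ->
  compact L -> L `<=` closure D `\` b_hull D A -> 0 < e ->
  (forall p, p \in s -> D p /\ ~ b_hull D A p) ->
  exists h, [/\ test_function D K h, forall p, p \in s -> ((- e)%:E < h p)%E &
    forall x, L x -> near_above D h e x].
Proof.
move=> BD AD pw w0 [z0 Dz0 wz0] wA cK KA cL LA e0 us.
have hA := sub_b_hull AD.
have [oD _ _ bD] := BD.1; rewrite bdryE// in AD.
have KD x : K x -> closure D x /\ ~ D x by move=> /KA/AD.
have clK : closed K by apply: compact_closed => //; exact: norm_hausdorff.
have ex : exists h, test_function D K h.
  have wK x : K x -> ustar D w x = -oo%E by move=> /KA/wA.
  have [h th _] := test_function_at_interior BD cK KD pw w0 wK Dz0 (elimN eqP wz0) e0.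
  by exists h.
have cLs : compact (L `|` [set` s]) by apply: compactU => //; apply: finite_compact; exact: finite_seq.
have [h th hL] : exists2 h, test_function D K h &
    forall x, (L `|` [set` s]) x -> near_above D h e x.
  apply: test_function_on_compact => // x Lsx.
  have [cx nAx] : closure D x /\ ~ b_hull D A x.
    by case: Lsx => [/LA[]|/us[/subset_closure]].
  have [Dx|nDx] := pselect (D x); last first.
    by apply: test_function_at_bdry => // /KA/hA.
  have [u [pu nu uA ux]] : exists u, [/\ psh D u, negative D u,
      forall x, A x -> ustar D u x = -oo%E & ustar D u x <> -oo%E].
    apply: contrapT => nu; apply: nAx; split=> // u pu _ neg uA.
    by apply: contrapT => ux; apply: nu; exists u.
  have uK y : K y -> ustar D u y = -oo%E by move=> Ky; apply: uA; exact: KA.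
  apply: (test_function_at_interior BD cK KD pu _ uK Dx _ e0).
  - by move=> z /nu/ltW.
  - by move=> /(ustar_Noo_in (u := u) _ Dx) ux'; apply/ux/ux'; case: pu.
exists h; split=> // [p ps|x Lx]; last by apply: hL; left.
have := hL p (or_intror ps); rewrite /near_above near_withinE => /nbhs_singleton.
by apply; case: (us p ps).
Qed.

Lemma negative_shift D u : open D -> psh D u -> (forall z, D z -> (u z <= 0)%E) ->
  [/\ psh D (fun z => u z + (- 1)%:E)%E, negative D (fun z => u z + (- 1)%:E)%E &
      forall x, ustar D (fun z => u z + (- 1)%:E)%E x = -oo%E <-> ustar D u x = -oo%E].
Proof.
move=> oD pu u0; split; first exact: psh_subr.
  move=> z Dz; apply: (@le_lt_trans _ _ (0 + (- 1)%:E)%E); first by rewrite leeD2r// u0.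
  by rewrite add0e lte_fin oppr_lt0.
move=> x; split=> /ustar_NooP ux; apply/ustar_NooP => a.
  by apply: filterS (ux (a - 1)) => z; rewrite EFinB lteD2rE.
apply: filterS (ux a) => z uza; apply: le_lt_trans uza.
by rewrite geeDl// lee_fin oppr_le0.
Qed.

End Exhaustion.

Unset Implicit Arguments.

Theorem corollary4p6 (R : realType) (n : nat) (D A : set 'rV[Cplx R]_n.+1) :
  B_regular D -> b_pluripolar D A -> Gdelta A -> Fsigma A ->
  completely_b_pluripolar D A /\
  (Gdelta (b_hull D A) ->
    (exists psi : 'rV[Cplx R]_n.+1 -> \bar R,
      [/\ psh D psi, negative D psi &
          b_hull D A = [set z | closure D z /\ ustar D psi z = -oo%E]]) /\
    completely_pluripolar D (b_hull D A `&` D)).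
Proof.
move=> BD [AD [w [pw w0 nw wA]]] [W oW AW] [F cF AF].
have [oD conD _ bD] := BD.1; have cD := bounded_compact_closure bD.
have [K [clK K_incr FK KF]] := closed_exhaustion cF.
have KA k : K k `<=` A by rewrite AF; exact: KF.
have cK k : compact (K k).
  by apply: (subclosed_compact (clK k) cD) => x /KA/AD[].
have [w1 w2 w3] := (pshP w oD).1 pw.
have w_dense := finite_dense oD conD w2 w0 w3 nw.
have e0 k : 0 < 2^-1 ^+ k :> R by rewrite exprn_gt0// invr_gt0.
split.
- pose Q := [set z | D z /\ w z <> -oo%E].
  have [M [clM M_incr WM MW]] := closed_exhaustion (fun i => open_closedC (oW i)).
  pose L k := bdry D `&` M k.
  have LA k : L k `<=` bdry D `\` A.
    by move=> x [Dx /MW[i _ nWx]]; split=> //; rewrite AW => /(_ i I).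
  have cL k : compact (L k).
    apply: (subclosed_compact _ cD); last by move=> x [[]].
    apply: closedI (clM k); rewrite /bdry setDE; apply: closedI; first exact: closed_closure.
    by apply: open_closedC; exact: open_interior.
  have [u [pu u0 nu uK uL]] : exists u : _ -> \bar R,
      [/\ psh D u, forall z, D z -> (u z <= 0)%E, nontrivial D u,
        forall k x, K k x -> ustar D u x = -oo%E &
        forall k x, L k x -> ustar D u x <> -oo%E].
    apply: (@series_construction R n D K L Q) => //.
    + by move=> z [].
    + move=> z r Dz r0; have [y Dy [yz wy]] := w_dense z r Dz r0.
      by exists y => //; split=> //; exact/eqP.
    + by case: nw => z Dz wz; exists z; split=> //; exact/eqP.
    + by move=> k x [bx /M_incr].
    + by move=> k x [[]].
    + by move=> k s Qs; apply: (boundary_summand BD AD pw w0 nw wA).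
  have [p1 p2 p3] := negative_shift oD pu u0.
  exists (fun z => u z + (- 1)%:E)%E; split=> //.
    case: nu => z Dz uz; exists z => //; move: uz.
    by case: (u z).
  apply/seteqP; split=> [z /= [bz /p3 uz]|z Az]; last first.
    split; first exact: AD.
    by apply/p3; move: Az; rewrite {1}AF => -[i _ /FK]; exact: uK.
  apply: contrapT => nAz; have [i nWz] : exists i, ~ W i z.
    apply: contrapT => nW; apply: nAz; rewrite AW => i _.
    by apply: contrapT => nWi; apply: nW; exists i.
  by apply: (uL i z) uz; split=> //; exact: WM.
- move=> [P oP HP].
  pose Q := [set z | D z /\ ~ b_hull D A z].
  have [M [clM M_incr PM MP]] := closed_exhaustion (fun i => open_closedC (oP i)).
  pose L k := closure D `&` M k.
  have LA k : L k `<=` closure D `\` b_hull D A.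
    by move=> x [Dx /MP[i _ nPx]]; split=> //; rewrite HP => /(_ i I).
  have cL k : compact (L k).
    apply: (subclosed_compact _ cD); last by move=> x [].
    by apply: closedI (clM k); exact: closed_closure.
  (* The hull meets [D] in a subset of the set where [w] is [-oo]. *)
  have wQ z : D z -> w z != -oo%E -> Q z.
    move=> Dz wz; split=> // -[_ hz]; have [q1 q2 q3] := negative_shift oD pw w0.
    have nq : nontrivial D (fun z => w z + (- 1)%:E)%E.
      by exists z => //; move: wz; case: (w z).
    have /q3 := hz _ q1 nq q2 (fun x Ax => (q3 x).2 (wA x Ax)).
    by move=> /(ustar_Noo_in w2 Dz)/eqP; apply/negP.
  have [u [pu u0 nu uK uL]] : exists u : _ -> \bar R,
      [/\ psh D u, forall z, D z -> (u z <= 0)%E, nontrivial D u,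
        forall k x, K k x -> ustar D u x = -oo%E &
        forall k x, L k x -> ustar D u x <> -oo%E].
    apply: (@series_construction R n D K L Q) => //.
    + by move=> z [].
    + move=> z r Dz r0; have [y Dy [yz wy]] := w_dense z r Dz r0.
      by exists y => //; exact: wQ.
    + by case: nw => z Dz wz; exists z; exact: wQ.
    + by move=> k x [bx /M_incr].
    + by move=> k x [].
    + by move=> k s Qs; apply: (hull_summand BD AD pw w0 nw wA).
  have [p1 p2 p3] := negative_shift oD pu u0.
  have hullE : b_hull D A =
      [set z | closure D z /\ ustar D (fun z => u z + (- 1)%:E)%E z = -oo%E].
    apply/seteqP; split=> [z [cz hz]|z /= [cz /p3 uz]].
      split=> //; apply: hz => //.
        by case: nu => y Dy uy; exists y => //; move: uy; case: (u y).
      by move=> x Ax; apply/p3; move: Ax; rewrite {1}AF => -[i _ /FK]; exact: uK.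
    apply: contrapT => nAz; have [i nPz] : exists i, ~ P i z.
      apply: contrapT => nP; apply: nAz; rewrite HP => i _.
      by apply: contrapT => nPi; apply: nP; exists i.
    by apply: (uL i z) uz; split=> //; exact: PM.
  split; first by exists (fun z => u z + (- 1)%:E)%E.
  exists (fun z => u z + (- 1)%:E)%E => //; rewrite hullE.
  have up : usc_on D (fun z => u z + (- 1)%:E)%E by case: p1.
  apply/seteqP; split=> z /=.
    by move=> [[_ uz] Dz]; split=> //; exact/(ustar_Noo_in up Dz).
  move=> [Dz uz]; split=> //; split; first exact: subset_closure.
  exact/(ustar_Noo_in up Dz).
Qed.
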